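(* Let $M$ be a closed connected Riemannian manifold and $f:M\to\mathbb{R}^+$ a smooth positive function. Let $\lambda_1$ be the first eigenvalue of the Laplace operator on $M$ (possibly of multiplicity larger than $1$) and $\mathscr{U}_1$ its eigenspace. Then $$\lambda_1(f)\leq\lambda_1 .$$ Moreover, $\lambda_1(f)<\lambda_1$ if $f$ is not orthogonal to $\mathscr{U}_1$ in $L^2(M,d\mu)$.
   Context: Let $d\mu$ be the Riemannian measure of $M$ and $\Delta$ the Laplace operator (divergence of the gradient). $\lambda_1$ is the smallest positive $\lambda$ for which $\Delta u=-\lambda u$ has a nonzero smooth solution, and $\mathscr{U}_1=\{u:\Delta u=-\lambda_1u\}$. The Rayleigh quotient of a nonzero smooth function is $R(u)=\int_M|\nabla u|^2d\mu\big/\int_M u^2d\mu$, and $\lambda_1(f)=\inf_{0\ne u\in f^\perp}R(u)$, where $f^\perp$ is the set of smooth functions $u$ with $\int_M fu\,d\mu=0$. *)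

(* Defs.v *)
From HB Require Import structures.
From mathcomp Require Import all_boot all_order all_algebra.
From mathcomp Require Import all_classical all_reals all_analysis.

Set Implicit Arguments.
Unset Strict Implicit.
Unset Printing Implicit Defensive.

Import Order.TTheory GRing.Theory Num.Theory.
Import numFieldNormedType.Exports.

Local Open Scope classical_set_scope.
Local Open Scope ring_scope.

(* Smooth means C^oo: Frechet differentiability of every iterated partial
   derivative on an open set makes all of them continuous there. *)
Definition partial (R : realType) (n : nat) (i : 'I_n) (f : 'rV[R]_n -> R) :
    'rV[R]_n -> R :=
  fun x => 'D_(delta_mx 0 i) f x.

Definition iter_partial (R : realType) (n : nat) (s : seq 'I_n)
    (f : 'rV[R]_n -> R) : 'rV[R]_n -> R :=
  foldr (@partial R n) f s.

Definition smooth_on (R : realType) (n : nat) (U : set 'rV[R]_n)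
    (f : 'rV[R]_n -> R) : Prop :=
  forall (s : seq 'I_n) (x : 'rV[R]_n), U x ->
    differentiable (iter_partial s f) x.

(* The type of charts is arbitrary, so any smooth atlas fits. [coord i] and
   [point i] matter only on [dom i] and [coord i @` dom i]; [chart_at] records
   that the charts cover M. *)
Record smooth_atlas (R : realType) (n : nat) (M : ptopologicalType) := {
  chart : Type;
  dom : chart -> set M;
  coord : chart -> M -> 'rV[R]_n;
  point : chart -> 'rV[R]_n -> M;
  chart_at : M -> chart;
  chart_atP : forall p, dom (chart_at p) p;
  dom_open : forall i, open (dom i);
  coord_open : forall i, open (coord i @` dom i);
  coordK : forall i p, dom i p -> point i (coord i p) = p;
  coord_continuous : forall i, {within dom i, continuous (coord i)};
  point_continuous : forall i,
    {within coord i @` dom i, continuous (point i)};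
  transition_smooth : forall i j (k : 'I_n),
    smooth_on (coord i @` (dom i `&` dom j)) (fun x => coord j (point i x) 0 k)
}.

Arguments chart {R n M} _.
Arguments dom {R n M} _.
Arguments coord {R n M} _.
Arguments point {R n M} _.
Arguments chart_at {R n M} _.

Definition smooth (R : realType) (n : nat) (M : ptopologicalType)
    (A : smooth_atlas R n M) (u : M -> R) : Prop :=
  forall i, smooth_on (coord A i @` dom A i) (u \o point A i).

(* [metric i p] is the Gram matrix (g_ab) at p of the coordinate frame of the
   chart i. MathComp's ['J h x] acts on row vectors, i.e. its (a, c) entry is
   the a-th partial derivative of the c-th component of h, so [metric_change]
   reads g_ab = (d_a y^c) (d_b y^d) g'_cd. *)
Record riemannian_metric (R : realType) (n : nat) (M : ptopologicalType)
    (A : smooth_atlas R n M) := {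
  metric : chart A -> M -> 'M[R]_n;
  metric_smooth : forall i (a b : 'I_n),
    smooth_on (coord A i @` dom A i) (fun x => metric i (point A i x) a b);
  metric_sym : forall i p, dom A i p -> (metric i p)^T = metric i p;
  metric_pos : forall i p (v : 'rV[R]_n), dom A i p -> v != 0 ->
    0 < (v *m metric i p *m v^T) 0 0;
  metric_change : forall i j p, dom A i p -> dom A j p ->
    let J := 'J (coord A j \o point A i) (coord A i p) in
    metric i p = J *m metric j p *m J^T
}.

Section differential_operators.
Variables (R : realType) (n : nat) (M : ptopologicalType).
Variables (A : smooth_atlas R n M) (g : riemannian_metric A).
Implicit Types (i : chart A) (u : M -> R) (X : M -> 'rV[R]_n) (p : M).

Definition volume_density i p : R := Num.sqrt (\det (metric g i p)).

(* Components X^a = g^ab d_b u in the chart i. *)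
Definition gradient i u p : 'rV[R]_n :=
  (\row_b partial b (u \o point A i) (coord A i p)) *m invmx (metric g i p).

(* |g|^(-1/2) d_a (|g|^(1/2) X^a), for X given by its components in the
   chart i. *)
Definition divergence i X p : R :=
  (volume_density i p)^-1 *
  \sum_a partial a (fun x => volume_density i (point A i x) * X (point A i x) 0 a)
                 (coord A i p).

(* The next two expressions do not depend on the chart around p. *)
Definition sq_norm_gradient u p : R :=
  let i := chart_at A p in
  (gradient i u p *m metric g i p *m (gradient i u p)^T) 0 0.

Definition laplacian u p : R :=
  let i := chart_at A p in divergence i (gradient i u) p.

Definition laplace_eigenspace (lambda : R) : set (M -> R) :=
  [set u | smooth A u /\ forall p, laplacian u p = - lambda * u p].

Definition is_positive_eigenvalue (lambda : R) : Prop :=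
  0 < lambda /\ exists2 u, laplace_eigenspace lambda u & exists p, u p != 0.

Definition is_first_eigenvalue (lambda : R) : Prop :=
  is_positive_eigenvalue lambda /\
  forall lambda', is_positive_eigenvalue lambda' -> lambda <= lambda'.

End differential_operators.

Notation borel M := (g_sigma_algebraType (@open M)).

(* Lebesgue measure on R^n, as the iterated product of the Lebesgue measure on
   the line. *)
Section lebesgue_tuple.
Variable R : realType.

Definition cons_tuple n (p : n.-tuple (measurableTypeR R) * measurableTypeR R) :
    n.+1.-tuple (measurableTypeR R) :=
  [the n.+1.-tuple (measurableTypeR R) of p.2 :: p.1].

Lemma measurable_cons_tuple n : measurable_fun setT (@cons_tuple n).
Proof. exact: measurable_cons. Qed.

Fixpoint lebesgue_tuple n :
    {measure set (n.-tuple (measurableTypeR R)) -> \bar R} :=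
  match n with
  | 0 => dirac [tuple]
  | m.+1 =>
      measure_function_pushforward__canonical__measure_function_Measure
        (lebesgue_tuple m \x lebesgue_measure)%E (@measurable_cons_tuple m)
  end.

Lemma lebesgue_tupleS n (B : set (n.+1.-tuple (measurableTypeR R))) :
  lebesgue_tuple n.+1 B =
  (lebesgue_tuple n \x lebesgue_measure)%E (@cons_tuple n @^-1` B).
Proof. by []. Qed.

Definition row_of_tuple n (t : n.-tuple R) : 'rV[R]_n := \row_i tnth t i.

End lebesgue_tuple.

Section riemannian_measure.
Variables (R : realType) (n : nat) (M : ptopologicalType).
Variables (A : smooth_atlas R n M) (g : riemannian_metric A).
Variable mu : {measure set (borel M) -> \bar R}.
Implicit Types u f : M -> R.

(* dmu = |g|^(1/2) dx^1 ... dx^n in every chart. *)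
Definition is_riemannian_measure : Prop :=
  forall i (B : set (borel M)), measurable B -> B `<=` dom A i ->
    mu B =
    (\int[lebesgue_tuple R n]_(t in @row_of_tuple R n @^-1` (coord A i @` B))
       (volume_density g i (point A i (row_of_tuple t)))%:E)%E.

Definition rayleigh u : R :=
  (\int[mu]_p sq_norm_gradient g u p) / (\int[mu]_p (u p ^+ 2)).

Definition L2_orthogonal f u : Prop := \int[mu]_p (f p * u p) = 0.

(* The infimum is taken in the extended reals, so that it is +oo rather than
   an arbitrary real number if there is no competitor. *)
Definition lambda1_of f : \bar R :=
  ereal_inf [set (rayleigh u)%:E | u in
    [set u | [/\ smooth A u, exists p, u p != 0 & L2_orthogonal f u]]].

End riemannian_measure.

(* Main.v *)
(* If u is an eigenfunction for lambda_1, then u has mean zero and its Dirichlet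
   energy is lambda_1 times its squared L^2 norm, so u - c, with c chosen to make
   it orthogonal to f, has Rayleigh quotient
   lambda_1 |u|^2 / (|u|^2 + c^2 vol M); this is at most lambda_1, with strict
   inequality when c <> 0, i.e. when u is not orthogonal to f.

   The mean and the energy of u come from the weak form of the eigenvalue
   equation. For a C^1 test function with compact support in one chart it is the
   divergence theorem in R^n, i.e. Fubini and the fundamental theorem of calculus
   along coordinate lines; a finite family of bump functions extends it to all
   C^1 test functions. *)

Require Import Defs.
From HB Require Import structures.
From mathcomp Require Import all_boot all_order all_algebra.
From mathcomp Require Import all_classical all_reals all_analysis.
From mathcomp Require Import measurable_realfun ring lra.
Import Order.TTheory GRing.Theory Num.Theory.
Import numFieldNormedType.Exports.
Local Open Scope classical_set_scope.
Local Open Scope ring_scope.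

Set Implicit Arguments.
Unset Strict Implicit.
Unset Printing Implicit Defensive.

Local Notation coord := Defs.coord.
Local Notation point := Defs.point.

(** * Functions of class C^1 on R^n *)

Section C1.
Context {R : realType}.

(** Two objects are pinned down only locally, and this shapes the proof. The Laplacian at a point is
    evaluated in the chart selected by [chart_at], which may jump from one point to the next, so the
    eigenvalue equation can be integrated by parts in a fixed chart only once the local expression
    is known not to depend on the chart. The measure [mu] is prescribed only on Borel sets inside a
    chart domain, so integrals are carried to R^n by approximation with simple functions.

    Test functions are kept at regularity C^1 because Green's formula differentiates them only once;
    bump functions can then be built from the square of the positive part. Of the two facts drawn
    from the weak equation, the mean comes from testing against the constant 1 and the energy from
    testing against the eigenfunction itself. *)

Lemma near_eq_differentiable (V W : normedModType R) (f g : V -> W) (x : V) :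
  {near x, f =1 g} -> differentiable f x -> differentiable g x.
Proof.
move=> fg /diff_locallyP [cdf dfx].
have E : g \o shift x = cst (g x) + 'd f x +o_ 0 id.
  apply/eqaddoP => _/posnumP[e].
  move/eqaddoP : dfx => /(_ e%:num (gt0 _)) dfx.
  have fg0 : \forall h \near 0, f (h + x) = g (h + x).
    by have := fg; rewrite [X in X -> _](near_shift 0) /= subr0.
  near=> h.
  have fgh : f (h + x) = g (h + x) by near: h.
  have -> : (g \o shift x - (cst (g x) + 'd f x)) h =
            (f \o shift x - (cst (f x) + 'd f x)) h.
    by rewrite !fctE /= fgh (nbhs_singleton fg).
  by near: h; exact: dfx.
apply/diff_locallyP; split.
  by rewrite (diff_unique cdf E).
by rewrite (diff_unique cdf E).
Unshelve. all: by end_near. Qed.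

(** A pointwise version of C^1: differentiability is asked near [x], so that formulas for the
    partial derivatives hold on a neighbourhood, but continuity of the partials only at [x]. At
    every point of an open set, this is C^1 there. *)
Definition C1_at n (f : 'rV[R]_n -> R) (x : 'rV[R]_n) :=
  (\forall y \near x, differentiable f y) /\
  forall a, {for x, continuous (partial a f)}.

Lemma near_neq0 (t : R) : t != 0 -> \forall s \near t, s != 0.
Proof. by move=> t0; apply: open_nbhs_nbhs; split => //; exact: open_neq. Qed.

Section closure.
Context {n : nat}.
Implicit Types (f g : 'rV[R]_n -> R) (x : 'rV[R]_n).

Lemma C1_at_differentiable f x : C1_at f x -> differentiable f x.
Proof. by case=> /nbhs_singleton. Qed.

Lemma C1_at_continuous f x : C1_at f x -> {for x, continuous f}.
Proof. by move/C1_at_differentiable; exact: differentiable_continuous. Qed.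

Lemma near_eq_partial f g x a : {near x, f =1 g} ->
  partial a f x = partial a g x.
Proof. exact: near_eq_derive. Qed.

Lemma near_eq_partial_near f g x a : {near x, f =1 g} ->
  {near x, partial a f =1 partial a g}.
Proof.
by move=> /near_join; apply: filterS => y; exact: near_eq_partial.
Qed.

Lemma near_eq_continuous_for (T U : topologicalType) (f g : T -> U) (x : T) :
  {near x, f =1 g} -> {for x, continuous f} -> {for x, continuous g}.
Proof.
move=> fg cf; have fgx : f x = g x := nbhs_singleton fg.
rewrite /prop_for /continuous_at -fgx.
exact: cvg_trans (near_eq_cvg fg) cf.
Qed.

Lemma continuous_for_sum (T : topologicalType) I (s : seq I) (F : I -> T -> R)
  (x : T) : (forall i, {for x, continuous (F i)}) ->
  {for x, continuous (fun y => \sum_(i <- s) F i y)}.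
Proof.
move=> cF; elim: s => [|i s IH].
  rewrite (_ : (fun y => _) = cst 0); first exact: cst_continuous.
  by apply/funext => y; rewrite big_nil.
rewrite (_ : (fun y => _) = (fun y => F i y + \sum_(i <- s) F i y)).
  by apply: (@continuousD _ _ _ (F i)); [exact: cF|exact: IH].
by apply/funext => y; rewrite big_cons.
Qed.

Lemma C1_at_near_eq f g x : {near x, f =1 g} -> C1_at f x -> C1_at g x.
Proof.
move=> fg [df cf]; split.
  move/near_join : fg => fg; near=> y.
  by apply: (@near_eq_differentiable _ _ f); near: y.
by move=> a; apply: near_eq_continuous_for (cf a); exact: near_eq_partial_near.
Unshelve. all: by end_near. Qed.

(** The form used for the closure properties: it suffices to exhibit the calculus formula for each
    partial derivative near [x] and to check its continuity at [x]. *)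
Lemma C1_at_partialE f (g : 'I_n -> 'rV[R]_n -> R) x :
  (\forall y \near x, differentiable f y) ->
  (forall a, {near x, partial a f =1 g a}) ->
  (forall a, {for x, continuous (g a)}) -> C1_at f x.
Proof.
move=> df fg cg; split=> [|a]; first exact: df.
by apply: near_eq_continuous_for (cg a); apply: filterS (fg a) => y ->.
Qed.

Lemma partialE f x a : differentiable f x ->
  partial a f x = 'd f x (delta_mx 0 a).
Proof. exact: deriveE. Qed.

Lemma C1_at_cst c x : C1_at (cst c) x.
Proof.
apply: (@C1_at_partialE _ (fun=> cst 0)).
- by near=> y; exact: differentiable_cst.
- by move=> a; near=> y; rewrite /partial derive_cst.
- by move=> a; exact: cst_continuous.
Unshelve. all: by end_near. Qed.

Lemma C1_atD f g x : C1_at f x -> C1_at g x -> C1_at (fun y => f y + g y) x.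
Proof.
move=> [df cf] [dg cg].
apply: (@C1_at_partialE _ (fun a y => partial a f y + partial a g y)).
- by near=> y; apply: differentiableD; near: y; [exact: df|exact: dg].
- move=> a; near=> y; rewrite /partial deriveD//; apply: diff_derivable; near: y;
    [exact: df|exact: dg].
- by move=> a; apply: continuousD; [exact: cf|exact: cg].
Unshelve. all: by end_near. Qed.

Lemma C1_atM f g x : C1_at f x -> C1_at g x -> C1_at (fun y => f y * g y) x.
Proof.
move=> Cf Cg; have [df cf] := Cf; have [dg cg] := Cg.
apply: (@C1_at_partialE _ (fun a y => f y * partial a g y + g y * partial a f y)).
- by near=> y; apply: differentiableM; near: y; [exact: df|exact: dg].
- move=> a; near=> y; rewrite /partial deriveM//; apply: diff_derivable; near: y;
    [exact: df|exact: dg].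
- move=> a; apply: continuousD; apply: continuousM.
  + exact: C1_at_continuous Cf.
  + exact: cg.
  + exact: C1_at_continuous Cg.
  + exact: cf.
Unshelve. all: by end_near. Qed.

Lemma C1_at_sum I (s : seq I) (P : pred I) (F : I -> 'rV[R]_n -> R) x :
  (forall i, P i -> C1_at (F i) x) ->
  C1_at (fun y => \sum_(i <- s | P i) F i y) x.
Proof.
move=> CF; elim: s => [|i s IH].
  by under eq_fun do rewrite big_nil; exact: C1_at_cst.
under eq_fun do rewrite big_cons.
by case Pi: (P i); [exact: (C1_atD (CF _ Pi) IH)|exact: IH].
Qed.

Lemma C1_at_prod I (s : seq I) (P : pred I) (F : I -> 'rV[R]_n -> R) x :
  (forall i, P i -> C1_at (F i) x) ->
  C1_at (fun y => \prod_(i <- s | P i) F i y) x.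
Proof.
move=> CF; elim: s => [|i s IH].
  by under eq_fun do rewrite big_nil; exact: C1_at_cst.
under eq_fun do rewrite big_cons.
by case Pi: (P i); [exact: (C1_atM (CF _ Pi) IH)|exact: IH].
Qed.

Lemma C1_at_comp (h : R -> R) f x : C1_at f x ->
  (\forall t \near f x, derivable h t 1) -> {for f x, continuous h^`()%classic} ->
  C1_at (h \o f) x.
Proof.
move=> Cf dh ch; have [df cf] := Cf.
have dhf : \forall y \near x, derivable h (f y) 1.
  by have cfx : f @ x --> f x := C1_at_continuous Cf; exact: cfx _ dh.
apply: (@C1_at_partialE _ (fun a y => h^`()%classic (f y) * partial a f y)).
- near=> y; apply: differentiable_comp; first by near: y; exact: df.
  by apply/derivable1_diffP; near: y; exact: dhf.
- move=> a; near=> y.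
  have dfy : differentiable f y by near: y; exact: df.
  have dhy : derivable h (f y) 1 by near: y; exact: dhf.
  have dhy' : differentiable h (f y) by exact/derivable1_diffP.
  rewrite /= partialE; last exact: differentiable_comp.
  rewrite diff_comp; [|exact: dfy|exact: dhy'].
  rewrite /= deriv1E; last exact: dhy.
  by rewrite -partialE; [rewrite mulrC|exact: dfy].
- move=> a; apply: continuousM; last exact: cf.
  by apply: continuous_comp; [exact: C1_at_continuous Cf|].
Unshelve. all: by end_near. Qed.

Lemma C1_at_oneminus f x : C1_at f x -> C1_at (fun y => 1 - f y) x.
Proof.
move=> Cf; have := C1_atD (C1_at_cst 1 x) (C1_atM (C1_at_cst (-1) x) Cf).
by under eq_fun do rewrite mulN1r.
Qed.

Lemma C1_atV f x : C1_at f x -> f x != 0 -> C1_at (fun y => (f y)^-1) x.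
Proof.
move=> Cf fx0; have [df cf] := Cf.
have fy0 : \forall y \near x, f y != 0.
  have cfx : f @ x --> f x := C1_at_continuous Cf.
  exact: cfx _ (near_neq0 _).
apply: (@C1_at_partialE _ (fun a y => - (f y) ^- 2 * partial a f y)).
- near=> y; apply: differentiableV; first by near: y; exact: df.
  by near: y; exact: fy0.
- move=> a; near=> y; rewrite /partial deriveV//; first by near: y; exact: fy0.
  by apply: diff_derivable; near: y; exact: df.
- move=> a; apply: continuousM; last exact: cf.
  apply: continuousN; apply: continuousV; first by rewrite expf_neq0.
  by apply: continuousM; exact: C1_at_continuous Cf.
Unshelve. all: by end_near. Qed.

Lemma C1_at_sqrt f x : C1_at f x -> 0 < f x ->
  C1_at (fun y => Num.sqrt (f y)) x.
Proof.
move=> Cf fx0; have pos : \forall t \near f x, 0 < t.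
  by apply: open_nbhs_nbhs; split => //; exact: open_gt.
apply: (@C1_at_comp Num.sqrt f) => //.
  by apply: filterS pos => t t0; have [] := is_derive1_sqrt t0.
apply: (@near_eq_continuous_for _ _ (fun t => (2 * Num.sqrt t)^-1)).
  by apply: filterS pos => t t0; rewrite derive1E; have [_ ->] := is_derive1_sqrt t0.
apply: continuousV; first by rewrite mulf_neq0// sqrtr_eq0 -ltNge.
by apply: continuousM; [exact: cst_continuous|exact: sqrt_continuous].
Qed.

Lemma C1_at_det m (F : 'I_m -> 'I_m -> 'rV[R]_n -> R) x :
  (forall i j, C1_at (F i j) x) ->
  C1_at (fun y => \det (\matrix_(i, j) F i j y)) x.
Proof.
move=> CF; rewrite /determinant.
apply: C1_at_sum => s _; apply: C1_atM; first exact: C1_at_cst.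
apply: C1_at_prod => i _; under eq_fun do rewrite mxE; exact: CF.
Qed.

Lemma C1_at_invmx m (F : 'rV[R]_n -> 'M[R]_m) x i j :
  (forall i j, C1_at (fun y => F y i j) x) -> \det (F x) != 0 ->
  C1_at (fun y => invmx (F y) i j) x.
Proof.
move=> CF dF.
have CdF : C1_at (fun y => \det (F y)) x.
  have := C1_at_det CF; congr C1_at; apply/funext => y; congr (\det _).
  by apply/matrixP => k l; rewrite mxE.
have dF0 : \forall y \near x, \det (F y) != 0.
  have cfx : (fun y => \det (F y)) @ x --> \det (F x) := C1_at_continuous CdF.
  exact: cfx _ (near_neq0 _).
(* [invmx] returns its argument when the matrix is singular, so the cofactor formula is used only
   near [x], where the determinant stays nonzero. *)
apply: (@C1_at_near_eq (fun y => (\det (F y))^-1 * cofactor (F y) j i)).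
  near=> y; have : F y \in unitmx.
    by rewrite unitmxE unitfE; near: y; exact: dF0.
  by rewrite /invmx => ->; rewrite !mxE.
apply: C1_atM; first exact: C1_atV.
rewrite /cofactor; apply: C1_atM; first exact: C1_at_cst.
have := @C1_at_det _ (fun k l y => F y (lift j k) (lift i l)) x (fun k l => CF _ _).
congr C1_at; apply/funext => y; congr (\det _).
by apply/matrixP => k l; rewrite !mxE.
Unshelve. all: by end_near. Qed.

(** [iter_partial] applies the head of the list last, so a derivative taken beforehand sits at the
    end of the list, whence [rcons]. *)
Lemma smooth_on_partial U f a : smooth_on U f -> smooth_on U (partial a f).
Proof.
move=> sf s x Ux; have := sf (rcons s a) x Ux.
by rewrite /iter_partial foldr_rcons.
Qed.

Lemma smooth_on_C1_at U f x : open U -> smooth_on U f -> U x -> C1_at f x.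
Proof.
move=> oU sf Ux; split.
  have : nbhs x U by exact: open_nbhs_nbhs.
  by apply: filterS => y Uy; exact: (sf [::]).
by move=> a; apply: differentiable_continuous; exact: (sf [:: a]).
Qed.

End closure.
End C1.

(** * Lebesgue measure on R^n *)

Section boxes.
Context {R : realType}.
Local Notation mR := (measurableTypeR R).
Local Notation leb := (@lebesgue_measure R).

Definition tuple_box n (S : 'I_n -> set R) : set (n.-tuple mR) :=
  [set t | forall i, S i (tnth t i)].

Lemma measurable_tuple_box n (S : 'I_n -> set R) :
  (forall i, measurable (S i : set mR)) -> measurable (tuple_box S).
Proof.
move=> mS; rewrite (_ : tuple_box S =
    \bigcap_(i in [set: 'I_n]) ((fun t : n.-tuple mR => tnth t i) @^-1` S i)).
  apply: fin_bigcap_measurable => // i _.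
  by rewrite -[X in measurable X]setTI; apply: measurable_tnth => //; exact: mS.
by apply/seteqP; split => [t tS i _|t tS i]; exact: tS.
Qed.

Lemma cons_tuple_box n (S : 'I_n.+1 -> set R) :
  @Defs.cons_tuple R n @^-1` tuple_box S =
  tuple_box (fun i => S (lift ord0 i)) `*` S ord0.
Proof.
apply/seteqP; split => [[t s] /= tS|[t s] /= [tS sS] i].
  split => [i|]; last by have := tS ord0; rewrite tnth0.
  by have := tS (lift ord0 i); rewrite tnthS.
case: (unliftP ord0 i) => [j|] ->; last by rewrite tnth0.
by rewrite tnthS; exact: tS.
Qed.

Lemma lebesgue_tuple_box n (S : 'I_n -> set R) :
  (forall i, measurable (S i : set mR)) ->
  lebesgue_tuple R n (tuple_box S) = (\prod_(i < n) leb (S i))%E.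
Proof.
elim: n S => [|n IH] S mS.
  rewrite /= big_ord0 diracE mem_set//.
  by case.
rewrite lebesgue_tupleS cons_tuple_box product_measure1E//.
- by rewrite IH// big_ord_recl muleC.
- exact: measurable_tuple_box.
Qed.

Definition cube n (r : R) : set (n.-tuple mR) :=
  tuple_box (fun=> `[- r, r]%classic).

Lemma measurable_cube n r : measurable (@cube n r).
Proof. by apply: measurable_tuple_box => i; exact: measurable_itv. Qed.

Lemma lebesgue_cube_lty n r : (lebesgue_tuple R n (cube r) < +oo)%E.
Proof.
rewrite lebesgue_tuple_box// ltey_eq; apply/orP; left.
by apply: prode_fin_num => i _; rewrite lebesgue_measure_itv/=; case: ifP.
Qed.

Lemma sigma_finite_lebesgue_tuple n : sigma_finite setT (lebesgue_tuple R n).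
Proof.
exists (fun k => @cube n k%:R); last first.
  by move=> k; split; [exact: measurable_cube|exact: lebesgue_cube_lty].
apply/esym; rewrite -subTset => t _.
have [k kt] : exists k : nat, forall i, `|tnth t i : R| <= k%:R.
  exists (\max_(i < n) (Num.truncn `|tnth t i : R|).+1)%N => i.
  apply: (@le_trans _ _ ((Num.truncn `|tnth t i : R|).+1%:R)).
    by rewrite ltW//; exact: truncnS_gt.
  by rewrite ler_nat; exact: leq_bigmax.
by exists k => // i; have := kt i; rewrite /= in_itv/= ler_norml.
Qed.

Lemma rV_ball_box n (x : 'rV[R]_n) e (t : n.-tuple mR) : 0 < e ->
  tuple_box (fun i => `]x 0 i - e, x 0 i + e[%classic) t <->
  ball x e (row_of_tuple t).
Proof.
move=> e0; split => [tB|[_ xt] i].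
  split=> // i j; have := tB j; rewrite ord1 mxE /ball/= in_itv/=.
  by rewrite distrC ltr_distl.
by have := xt ord0 i; rewrite mxE /ball/= in_itv/= distrC ltr_distl.
Qed.

(** The sigma-algebra on tuples is generated by the coordinates, so an open set has to be written as
    a countable union of boxes. Boxes are balls of the sup norm; those with rational centre and
    radius [1/(k+1)] that lie in [U] suffice. *)
Lemma open_measurable_row_of_tuple n (U : set 'rV[R]_n) : open U ->
  measurable (@row_of_tuple R n @^-1` U : set (n.-tuple mR)).
Proof.
move=> oU.
pose c (q : 'rV[rat]_n) : 'rV[R]_n := map_mx ratr q.
pose B (qk : 'rV[rat]_n * nat) : set (n.-tuple mR) :=
  if `[< ball (c qk.1) (qk.2.+1%:R^-1) `<=` U >] then
  tuple_box (fun i => `]c qk.1 0 i - qk.2.+1%:R^-1, c qk.1 0 i + qk.2.+1%:R^-1[%classic)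
  else set0.
rewrite (_ : _ @^-1` _ = \bigcup_qk B qk).
  apply: countable_bigcupT_measurable => // -[q k]; rewrite /B; case: ifP => _.
    by apply: measurable_tuple_box => i; exact: measurable_itv.
  exact: measurable0.
apply/seteqP; split => [t /= Ut|t [[q k] _]]; last first.
  rewrite /B; case: asboolP => // BU tB; apply: BU.
  by apply/rV_ball_box.
have /nbhs_ballP[e /= e0 eU] := open_nbhs_nbhs (conj oU Ut).
(* A radius below [e / 2]: once the centre is within one radius of [t], the whole ball stays within
   [e] of [t]. *)
have [k ke] : exists k : nat, k.+1%:R^-1 < e / 2.
  have e20 : 0 < e / 2 by rewrite divr_gt0.
  exists (Num.truncn (e / 2)^-1).
  by rewrite invf_plt ?posrE// truncnS_gt.
have [q qt] : exists q : 'rV[rat]_n, forall i,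
    ratr (q 0 i) \in `](tnth t i : R) - k.+1%:R^-1, (tnth t i : R) + k.+1%:R^-1[.
  have H i : exists r : rat, ratr r \in
      `](tnth t i : R) - k.+1%:R^-1, (tnth t i : R) + k.+1%:R^-1[.
    by apply: rat_in_itvoo; rewrite ltrD2l gt0_cp// invr_gt0.
  have [q Hq] := choice H.
  by exists (\row_i q i) => i; rewrite mxE.
have qB : ball (c q) k.+1%:R^-1 (row_of_tuple t).
  split=> [|i j]; first by rewrite invr_gt0.
  rewrite ord1 !mxE /ball/= ltr_distl.
  by have := qt j; rewrite in_itv/=.
exists (q, k) => //; rewrite /B; case: asboolP => [_|]; first exact/rV_ball_box.
case => y qy; apply: eU; rewrite [e]splitr.
apply: (@ball_triangle _ _ (c q)); last exact: (le_ball (ltW ke) qy).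
by apply: ball_sym; exact: (le_ball (ltW ke) qB).
Qed.

Lemma measurable_continuous_row_of_tuple n (U : set 'rV[R]_n) (F : 'rV[R]_n -> R) :
  open U -> (forall x, U x -> {for x, continuous F}) ->
  measurable_fun (@row_of_tuple R n @^-1` U : set (n.-tuple mR)) (F \o @row_of_tuple R n).
Proof.
move=> oU cF mD; apply: (measurability _ (RGenOpens.measurableE R)) => //.
move=> _ [_ [a [b ->] <-]]; pose V : set R := `]a, b[%classic.
have oV : open V by exact: interval_open.
rewrite -[X in measurable X]/(@row_of_tuple R n @^-1` (U `&` F @^-1` V)).
apply: open_measurable_row_of_tuple.
rewrite openE => x [Ux Vx]; apply: filterI; first exact: open_nbhs_nbhs.
by apply: cF => //; exact: open_nbhs_nbhs.
Qed.

Lemma measurable_row_of_tuple_continuous n (F : 'rV[R]_n -> R) : continuous F ->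
  measurable_fun setT (F \o @row_of_tuple R n : n.-tuple mR -> mR).
Proof.
move=> cF; have := measurable_continuous_row_of_tuple openT (fun x _ => cF x).
by rewrite preimage_setT.
Qed.

Lemma integrable_bounded_supported d (T : measurableType d)
    (mu : {measure set T -> \bar R}) (D : set T) (G : T -> R) (C : R) :
  measurable D -> (mu D < +oo)%E -> measurable_fun setT G ->
  (forall t, `|G t| <= C) -> (forall t, ~ D t -> G t = 0) ->
  mu.-integrable setT (EFin \o G).
Proof.
move=> mD muD mG GC GD.
have iD : mu.-integrable D (EFin \o G).
  apply: measurable_bounded_integrable => //; first exact: measurable_funTS.
  by exists C; split; [exact: num_real|move=> x Cx t _; exact: le_trans (GC t) (ltW Cx)].
move/(integrable_mkcond _ mD) : iD; apply: eq_integrable => // t _.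
by rewrite /patch; case: ifPn => //; rewrite notin_setE => /GD /= ->.
Qed.

(* A transparent alias of [lebesgue_tuple R n], carrying the sigma-finite
   structure required by Fubini's theorem. *)
Definition lebesgue_tuple_sigma_finite n : set (n.-tuple mR) -> \bar R :=
  lebesgue_tuple R n.

HB.instance Definition _ n := Measure.copy (@lebesgue_tuple_sigma_finite n)
  (lebesgue_tuple R n : set (n.-tuple mR) -> \bar R).

HB.instance Definition _ n := @Measure_isSigmaFinite.Build _ _ _
  (@lebesgue_tuple_sigma_finite n) (sigma_finite_lebesgue_tuple n).

Definition set_tnth n (t : n.-tuple mR) (a : 'I_n) (s : R) : n.-tuple mR :=
  [tuple if i == a then s else tnth t i | i < n].

(** Fubini, by induction along the recursive definition of Lebesgue measure. Boundedness and support
    in a cube make [G] integrable, so either order of integration may be chosen. *)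
Lemma integral_lines_eq0 n (a : 'I_n) (G : n.-tuple mR -> R) (B C : R) :
  measurable_fun setT G -> (forall t, `|G t| <= C) ->
  (forall t, ~ cube B t -> G t = 0) ->
  (forall t, \int[leb]_s (G (set_tnth t a s))%:E = 0)%E ->
  (\int[lebesgue_tuple R n]_t (G t)%:E = 0)%E.
Proof.
elim: n a G => [[]//|n IH] a G mG GC GB Ga.
pose c := @Defs.cons_tuple R n.
have mc : measurable_fun setT c by exact: Defs.measurable_cons_tuple.
pose m1 := @lebesgue_tuple_sigma_finite n.
have iG : (m1 \x leb)%E.-integrable setT (EFin \o (G \o c)).
  apply: (@integrable_bounded_supported _ _ _ (c @^-1` cube B) _ C).
  - by rewrite -[X in measurable X]setTI; apply: mc => //; exact: measurable_cube.
  - have := @lebesgue_cube_lty n.+1 B; rewrite lebesgue_tupleS; exact.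
  - exact: measurableT_comp.
  - by move=> t; exact: GC.
  - by move=> t ct; exact: GB.
have -> : (\int[lebesgue_tuple R n.+1]_t (G t)%:E =
    \int[(m1 \x leb)%E]_p (G (c p))%:E)%E.
  rewrite [LHS](@integral_pushforward _ _ _ _ _ c mc _ setT (EFin \o G))//.
  by apply/measurable_EFinP.
(* [c] takes a pair (tail, head). If the direction [a] lies in the tail, the tail is integrated
   first, at a fixed head, by induction; if it is the head, the head is integrated first. *)
case: (unliftP ord0 a) => [b ab|a0].
  rewrite -(integral21_prod_meas1 iG) /fubini_G /=.
  rewrite [LHS](_ : _ = \int[leb]_x (0 : \bar R))%E; last first.
    apply: eq_integral => s _; apply: (IH b (fun t => G (c (t, s)))).
    - by apply: measurableT_comp => //; apply: measurableT_comp => //;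
        exact: measurable_pair1.
    - by move=> t; exact: GC.
    - move=> t tB; apply: GB => ctB; apply: tB => i.
      by have := ctB (lift ord0 i); rewrite tnthS.
    - move=> t; rewrite -[RHS](Ga (c (t, s))); apply: eq_integral => u _.
      congr (G _)%:E; apply: eq_from_tnth => i; rewrite tnth_mktuple.
      case: (unliftP ord0 i) => [j|] ->; last by rewrite !tnth0 ab.
      by rewrite !tnthS tnth_mktuple ab (inj_eq lift_inj).
  by rewrite integral0.
rewrite -(integral12_prod_meas1 iG) /fubini_F /=.
rewrite [LHS](_ : _ = \int[m1]_x (0 : \bar R))%E; last first.
  (* The head 0 is a placeholder, overwritten by [set_tnth]. *)
  apply: eq_integral => t _; rewrite -[RHS](Ga (c (t, 0))); apply: eq_integral => u _.
  congr (G _)%:E; apply: eq_from_tnth => i; rewrite tnth_mktuple.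
  by case: (unliftP ord0 i) => [j|] ->; rewrite ?tnth0 ?tnthS a0.
by rewrite integral0.
Qed.

End boxes.

(** * The divergence theorem on R^n for compactly supported functions *)

Section euclidean_divergence.
Context {R : realType} {n : nat}.
Local Notation mR := (measurableTypeR R).
Implicit Types (F G : 'rV[R]_n -> R).

(** The strict inequality makes the region where [F] must vanish open, so partial derivatives
    inherit the property. The sign of [r] is left free. *)
Definition cube_supported (r : R) F :=
  forall (x : 'rV[R]_n) i, r < `|x 0 i| -> F x = 0.

Lemma cube_supported_row_of_tuple r F (t : n.-tuple mR) :
  cube_supported r F -> ~ cube r t -> F (row_of_tuple t) = 0.
Proof.
move=> Fr; rewrite /cube => /existsNP[i] /= tr.
apply: (Fr _ i); rewrite mxE ltNge; apply/negP => h; apply: tr.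
by rewrite in_itv/= -ler_norml.
Qed.

Lemma cube_supported_partial r F a : cube_supported r F ->
  cube_supported r (partial a F).
Proof.
move=> Fr x i xr; rewrite (@near_eq_partial _ _ _ (cst 0)).
  by rewrite /partial derive_cst.
have cx : (fun y : 'rV[R]_n => `|y 0 i|) @ x --> `|x 0 i|.
  by apply: continuous_comp; [exact: coord_continuous|exact: norm_continuous].
have rx : nbhs `|x 0 i| [set t | r < t].
  by apply: open_nbhs_nbhs; split => //; exact: open_gt.
have : nbhs x [set y : 'rV[R]_n | r < `|y 0 i|] := cx _ rx.
by apply: filterS => y; exact: Fr.
Qed.

Lemma cube_supported_bounded r F : continuous F -> cube_supported r F ->
  exists C, forall x, `|F x| <= C.
Proof.
move=> cF Fr.
have K : compact [set v : 'rV[R]_n | forall i, v ord0 i \in `[- r, r]].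
  by apply: (@rV_compact _ _ (fun=> `[- r, r]%classic)) => _; exact: segment_compact.
have /compact_bounded[C [_ HC]] : compact
    (F @` [set v : 'rV[R]_n | forall i, v ord0 i \in `[- r, r]]).
  by apply: continuous_compact K; exact: continuous_subspaceT.
exists (Num.max 0 (C + 1)) => x.
have [xK|/existsNP[i xi]] := pselect (forall i, x ord0 i \in `[- r, r]).
  rewrite le_max; apply/orP; right.
  by apply: HC; [rewrite ltrDl|exists x].
rewrite (Fr x i) ?normr0 ?le_max ?lexx// ltNge; apply/negP => h; apply: xi.
by rewrite in_itv/= -ler_norml.
Qed.

Lemma cube_supported_integrable r F : continuous F -> cube_supported r F ->
  (lebesgue_tuple R n).-integrable setT (EFin \o (F \o @row_of_tuple R n)).
Proof.
move=> cF Fr; have [C FC] := cube_supported_bounded cF Fr.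
apply: (@integrable_bounded_supported _ _ _ _ (cube r) _ C).
- exact: measurable_cube.
- exact: lebesgue_cube_lty.
- exact: measurable_row_of_tuple_continuous.
- by move=> t; exact: FC.
- by move=> t; exact: cube_supported_row_of_tuple.
Qed.

Lemma row_of_set_tnth (t : n.-tuple mR) a (s : R) :
  row_of_tuple (set_tnth t a s) =
  row_of_tuple (set_tnth t a 0) + s *: delta_mx 0 a :> 'rV[R]_n.
Proof.
apply/rowP => j; rewrite !mxE !tnth_mktuple eqxx/=.
by case: eqP => _; rewrite ?mulr1 ?mulr0 ?addr0 ?add0r.
Qed.

Lemma is_derive_line F (x : 'rV[R]_n) a (s : R) :
  differentiable F (x + s *: delta_mx 0 a) ->
  is_derive s 1 (fun u => F (x + u *: delta_mx 0 a))
    (partial a F (x + s *: delta_mx 0 a)).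
Proof.
move=> dF'.
have dF : derivable F (x + s *: delta_mx 0 a) (delta_mx 0 a).
  exact: diff_derivable.
have E : (fun h : R => h^-1 *: (((fun u => F (x + u *: delta_mx 0 a)) \o shift s) (h *: 1)
           - F (x + s *: delta_mx 0 a))) =
    (fun h : R => h^-1 *: ((F \o shift (x + s *: delta_mx 0 a)) (h *: delta_mx 0 a)
           - F (x + s *: delta_mx 0 a))).
  apply/funext => h /=; congr (_ *: (F _ - _)).
  by rewrite [h *: 1]mulr1 scalerDl addrCA.
split; first by rewrite /derivable E.
by rewrite /partial /derive E.
Qed.

Lemma integral_partial_eq0 r F a : (forall x, C1_at F x) ->
  cube_supported r F ->
  (\int[lebesgue_tuple R n]_t (partial a F (row_of_tuple t))%:E = 0)%E.
Proof.
move=> CF Fr.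
have cdF : continuous (partial a F) by move=> x; exact: (CF x).2.
have dFr := cube_supported_partial a Fr.
have [C dFC] := cube_supported_bounded cdF dFr.
apply: (@integral_lines_eq0 _ _ a _ r C).
- exact: measurable_row_of_tuple_continuous.
- by move=> t; exact: dFC.
- by move=> t; exact: cube_supported_row_of_tuple.
move=> t; pose x := row_of_tuple (set_tnth t a 0) : 'rV[R]_n.
pose p (s : R) := F (x + s *: delta_mx 0 a).
have xa s : (x + s *: delta_mx 0 a : 'rV[R]_n) 0 a = s.
  by rewrite !mxE tnth_mktuple !eqxx mulr1 add0r.
have dp (s : R) : is_derive s 1 p (partial a F (x + s *: delta_mx 0 a)).
  by apply: is_derive_line; exact: C1_at_differentiable.
have cline : continuous (fun s : R => x + s *: delta_mx 0 a : 'rV[R]_n).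
  move=> s; apply: (@cvgD _ _ _ _ _ (fun=> x)); first exact: cvg_cst.
  exact: scalel_continuous.
(* [r] may be negative, and the endpoints must lie strictly beyond it for [F] to vanish there. *)
pose B := `|r| + 1.
have B0 : 0 < B by rewrite ltr_wpDl.
have rB : r < B by rewrite (le_lt_trans (ler_norm _))// ltrDl.
have pB s : B <= `|s| -> partial a F (x + s *: delta_mx 0 a) = 0.
  by move=> Bs; apply: (dFr _ a); rewrite xa (lt_le_trans rB).
under eq_integral do rewrite row_of_set_tnth -/x.
pose q (s : R) := partial a F (x + s *: delta_mx 0 a).
transitivity (\int[lebesgue_measure]_(s in `[(- B)%R, B]) (q s)%:E)%E.
  rewrite [RHS]integral_mkcond; apply: eq_integral => s _.
  rewrite /patch; case: ifPn => //; rewrite notin_setE /= in_itv/= -ler_norml.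
  by move/negP; rewrite -ltNge => /ltW /pB ->.
rewrite (@continuous_FTC2 _ _ p).
- by rewrite /p !(Fr _ a) ?subee// xa ?normrN ger0_norm// ltW.
- by rewrite gt0_cp.
- apply: continuous_subspaceT => s.
  by apply: continuous_comp; [exact: cline|exact: cdF].
- have cp : continuous p.
    by move=> s; apply: differentiable_continuous; apply/derivable1_diffP; case: (dp s).
  split.
  + by move=> s _; case: (dp s).
  + by apply: cvg_at_right_filter; exact: cp.
  + by apply: cvg_at_left_filter; exact: cp.
- by move=> s _; rewrite derive1E; case: (dp s).
Qed.

End euclidean_divergence.

(** * Change of variables for a measure with density *)

Section integral_transport.
Local Open Scope ereal_scope.
Context d1 d2 (X : measurableType d1) (Y : measurableType d2) (R : realType).
Variables (mu : {measure set X -> \bar R}) (m : {measure set Y -> \bar R}).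
Variables (D : set X) (E : set Y) (T : Y -> X) (w : Y -> R).
Hypotheses (mD : measurable D) (mE : measurable E) (mT : measurable_fun E T).
Hypotheses (mw : measurable_fun E w) (w0 : forall y, E y -> (0 <= w y)%R).
Hypothesis ET : forall y, E y -> D (T y).
Hypothesis mu_density : forall B, measurable B -> B `<=` D ->
  mu B = \int[m]_(y in E `&` T @^-1` B) (w y)%:E.

Import HBNNSimple.

(** The hypothesis on [mu] is the case of indicator functions; linearity extends it to nonnegative
    simple functions, and monotone convergence on both sides to [h]. *)
Lemma ge0_integral_transport (h : X -> \bar R) :
  measurable_fun D h -> (forall x, D x -> 0 <= h x) ->
  \int[mu]_(x in D) h x = \int[m]_(y in E) (h (T y) * (w y)%:E).
Proof.
move=> mh h0; pose f_ := nnsfun_approx mD mh.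
have mfT n : measurable_fun E (f_ n \o T).
  by apply: (measurable_comp measurableT) => //; exact: subsetT.
have mg n : measurable_fun E (fun y => (f_ n (T y))%:E * (w y)%:E).
  by apply/measurable_EFinP; apply: measurable_funM => //; exact: mfT.
transitivity (limn (fun n => \int[mu]_(x in D) (f_ n x)%:E)).
  rewrite -monotone_convergence//.
  - apply: eq_integral => x /[!inE] xD; apply/esym/cvg_lim => //.
    exact: cvg_nnsfun_approx.
  - by move=> n; exact/measurable_EFinP/measurable_funTS.
  - by move=> n y _; rewrite lee_fin.
  - by move=> y _ k n kn; rewrite lee_fin; exact/lefP/nd_nnsfun_approx.
transitivity (limn (fun n => \int[m]_(y in E) ((f_ n (T y))%:E * (w y)%:E))); last first.
  rewrite -monotone_convergence//.
  - apply: eq_integral => y /[!inE] yE; apply/cvg_lim => //.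
    apply: cvgeZr => //; apply: (@cvg_nnsfun_approx _ _ _ _ mD _ mh) => //.
    exact: ET.
  - by move=> n y Ey; rewrite -EFinM lee_fin mulr_ge0// w0.
  - move=> y Ey k n kn; rewrite -!EFinM lee_fin ler_wpM2r ?w0//.
    exact/lefP/nd_nnsfun_approx.
congr (limn _); apply/funext => n.
have mA r : measurable (f_ n @^-1` [set r]) by exact: measurable_sfunP.
transitivity (\sum_(r \in range (f_ n)) r%:E * mu (f_ n @^-1` [set r] `&` D)).
  under eq_integral do rewrite fimfunE -fsumEFin//.
  rewrite ge0_integral_fsum//; last 2 first.
  - by move=> y; apply/measurable_EFinP/measurable_funM => //; exact: measurable_funTS.
  - by move=> y x _; rewrite nnfun_muleindic_ge0.
  by apply: eq_fsbigr => r _; rewrite integralZl_indic_nnsfun// integral_indic.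
transitivity (\sum_(r \in range (f_ n))
    \int[m]_(y in E) ((r * \1_(f_ n @^-1` [set r]) (T y))%:E * (w y)%:E)).
  apply: eq_fsbigr => r _.
  (* Pulling the scalar [r] out of the integral uses [0 <= r]; for negative [r] the level set is
     empty and both sides are 0. *)
  have [r0|r0] := ltP r 0%R.
    rewrite preimage_nnfun0// set0I measure0 mule0 integral0_eq// => y _.
    by rewrite indic0 mulr0 mul0e.
  rewrite mu_density; [|exact: measurableI|by move=> ? []].
  under [RHS]eq_integral do rewrite EFinM -muleA.
  rewrite ge0_integralZl_EFin//.
  - congr (_ * _); rewrite (_ : _ `&` _ = E `&` T @^-1` (f_ n @^-1` [set r])).
      rewrite integral_mkcondr; apply: eq_integral => y _.
      rewrite /patch indicE; case: ifPn => [|].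
        by rewrite inE/= => yr; rewrite mem_set// mul1e.
      by rewrite notin_setE/= => yr; rewrite memNset// mul0e.
    by apply/seteqP; split => [y [Ey [? ?]]|y [Ey ?]]; split => //; split => //; exact: ET.
  - by move=> y Ey; rewrite -EFinM lee_fin mulr_ge0// w0.
  - apply/measurable_EFinP/measurable_funM => //.
    by apply: (measurable_comp measurableT) => //; exact: subsetT.
rewrite -ge0_integral_fsum//.
- apply: eq_integral => y Ey; rewrite [in RHS]fimfunE -fsumEFin//.
  rewrite ge0_mule_fsuml// => r; exact: nnfun_muleindic_ge0.
- move=> r; apply/measurable_EFinP/measurable_funM => //; apply: measurable_funM => //.
  by apply: (measurable_comp measurableT) => //; exact: subsetT.
- by move=> r y Ey; rewrite mule_ge0 ?nnfun_muleindic_ge0// lee_fin w0.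
Qed.

(** The integral is the difference of those of the positive and negative parts, and multiplication
    by [w >= 0] commutes with taking these parts. *)
Lemma integral_transport (h : X -> R) :
  measurable_fun D h ->
  \int[mu]_(x in D) (h x)%:E = \int[m]_(y in E) (h (T y) * w y)%:E.
Proof.
move=> mh; have mh' : measurable_fun D (EFin \o h) by exact/measurable_EFinP.
rewrite [LHS]integralE [RHS]integralE; congr (_ - _).
  rewrite ge0_integral_transport//; last exact: measurable_funepos.
  apply: eq_integral => y /[!inE] Ey; rewrite !funeposE.
  by rewrite -!EFin_max -EFinM maxr_pMl ?w0// mul0r.
rewrite ge0_integral_transport//; last exact: measurable_funeneg.
apply: eq_integral => y /[!inE] Ey; rewrite !funenegE.
by rewrite -!EFin_max -EFinM maxr_pMl ?w0// mul0r mulNr.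
Qed.

End integral_transport.

(** * Charts and the gradient form *)

Section positive_definite.
Context {R : realType} {n : nat}.
Implicit Types G : 'M[R]_n.

Lemma posdef_det_neq0 G :
  (forall v : 'rV[R]_n, v != 0 -> 0 < (v *m G *m v^T) 0 0) -> \det G != 0.
Proof.
move=> Gpos; apply/det0P => -[v v0 vG].
by have := Gpos v v0; rewrite vG mul0mx mxE ltxx.
Qed.

(* The determinant cannot change sign along the segment from the identity
   to [G]. *)
Lemma posdef_det_gt0 G :
  (forall v : 'rV[R]_n, v != 0 -> 0 < (v *m G *m v^T) 0 0) -> 0 < \det G.
Proof.
move=> Gpos.
pose P : {poly R} := \det (map_mx polyC 1%:M + 'X *: map_mx polyC (G - 1%:M)).
have PE t : P.[t] = \det ((1 - t) *: 1%:M + t *: G).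
  rewrite /P -[LHS]/(horner_eval t _) -det_map_mx; congr (\det _).
  by apply/matrixP => i j; rewrite !mxE /= /horner_eval hornerD hornerM !hornerE; ring.
have v1 (v : 'rV[R]_n) : v != 0 -> 0 < (v *m v^T) 0 0.
  move=> v0; rewrite mxE lt_neqAle; apply/andP; split; last first.
    by apply: sumr_ge0 => i _; rewrite mxE -expr2 sqr_ge0.
  rewrite eq_sym psumr_neq0; last by move=> i _; rewrite mxE -expr2 sqr_ge0.
  have [i vi] : exists i, v 0 i != 0.
    apply/existsP; rewrite -negb_forall; apply: contra v0 => /forallP v0.
    by apply/eqP/rowP => i; rewrite mxE; apply/eqP.
  by apply/hasP; exists i; rewrite ?mem_index_enum// mxE -expr2 exprn_even_gt0.
have P0 t : 0 <= t <= 1 -> P.[t] != 0.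
  move=> /andP[t0 t1]; rewrite PE; apply: posdef_det_neq0 => v v0.
  rewrite mulmxDr mulmxDl -!scalemxAr -!scalemxAl mulmx1.
  rewrite [X in 0 < X]mxE [X in 0 < X + _]mxE [X in 0 < _ + X]mxE.
  have := v1 v v0; have := Gpos v v0; nra.
rewrite ltNge; apply/negP => G0.
have H : (- P).[0] <= 0 <= (- P).[1].
  rewrite !hornerN !PE !(subr0, subrr, scale1r, scale0r, addr0, add0r) det1.
  by rewrite oppr_le0 ler01 oppr_ge0.
have [t t01] := poly_ivt ler01 H.
by rewrite rootN => /rootP; apply/eqP/P0.
Qed.

End positive_definite.

Section charts.
Context {R : realType} {n : nat} {M : ptopologicalType}.
Variable A : smooth_atlas R n M.
Implicit Types (i j : chart A) (p : M) (u w : M -> R) (x : 'rV[R]_n).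

Definition chart_image i := coord A i @` dom A i.

Lemma chart_image_coord i p : dom A i p -> chart_image i (coord A i p).
Proof. by move=> ip; exists p. Qed.

Lemma point_dom i x : chart_image i x -> dom A i (point A i x).
Proof. by move=> [p ip <-]; rewrite coordK. Qed.

Lemma pointK i x : chart_image i x -> coord A i (point A i x) = x.
Proof. by move=> [p ip <-]; rewrite coordK. Qed.

Lemma open_chart_image i : open (chart_image i).
Proof. exact: coord_open. Qed.

Lemma near_dom i p : dom A i p -> \forall q \near p, dom A i q.
Proof. by move=> ip; apply: open_nbhs_nbhs; split => //; exact: dom_open. Qed.

Lemma near_chart_image i x : chart_image i x ->
  \forall y \near x, chart_image i y.
Proof. by move=> ix; apply: open_nbhs_nbhs; split => //; exact: open_chart_image. Qed.

Lemma coord_continuous_at i p : dom A i p -> coord A i @ p --> coord A i p.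
Proof.
have := @Defs.coord_continuous _ _ _ A i.
rewrite continuous_open_subspace; last exact: dom_open.
by move=> c ip; apply: c; rewrite inE.
Qed.

Lemma point_continuous_at i x : chart_image i x ->
  point A i @ x --> point A i x.
Proof.
have := @point_continuous _ _ _ A i.
rewrite continuous_open_subspace; last exact: open_chart_image.
by move=> c ip; apply: c; rewrite inE.
Qed.

Lemma near_point i x (P : M -> Prop) : chart_image i x ->
  (\forall q \near point A i x, P q) -> \forall y \near x, P (point A i y).
Proof. by move=> ix Pq; have c := point_continuous_at ix; exact: c _ Pq. Qed.

Lemma near_coord i p (P : 'rV[R]_n -> Prop) : dom A i p ->
  (\forall y \near coord A i p, P y) -> \forall q \near p, P (coord A i q).
Proof. by move=> ip Py; have c := coord_continuous_at ip; exact: c _ Py. Qed.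

Lemma continuous_at_chart i p (h : M -> R) : dom A i p ->
  {for coord A i p, continuous (h \o point A i)} -> {for p, continuous h}.
Proof.
move=> ip ch.
apply: (@near_eq_continuous_for _ _ ((h \o point A i) \o coord A i)).
  by near=> q; rewrite /= coordK//; near: q; exact: near_dom.
by apply: continuous_comp; [exact: coord_continuous_at|exact: ch].
Unshelve. all: by end_near. Qed.

Definition C1M w := forall i x, chart_image i x -> C1_at (w \o point A i) x.

Lemma C1M_continuous w : C1M w -> continuous w.
Proof.
move=> Cw p; apply: (@continuous_at_chart (chart_at A p)); first exact: chart_atP.
by apply: C1_at_continuous; apply: Cw; apply: chart_image_coord; exact: chart_atP.
Qed.

Lemma smooth_C1M w : smooth A w -> C1M w.
Proof.
move=> sw i x ix.
exact: (smooth_on_C1_at (@open_chart_image i) (sw i) ix).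
Qed.

Lemma C1M_cst c : C1M (cst c).
Proof. by move=> i x ix; exact: (C1_at_cst c). Qed.

Lemma C1MM u w : C1M u -> C1M w -> C1M (fun p => u p * w p).
Proof. by move=> Cu Cw i x ix; exact: C1_atM (Cu i x ix) (Cw i x ix). Qed.

Lemma C1M_oneminus u : C1M u -> C1M (fun p => 1 - u p).
Proof. by move=> Cu i x ix; exact: C1_at_oneminus (Cu i x ix). Qed.

Lemma C1M_differentiable i p w : dom A i p -> C1M w ->
  differentiable (w \o point A i) (coord A i p).
Proof. by move=> ip Cw; exact: C1_at_differentiable (Cw i _ (chart_image_coord ip)). Qed.

Definition overlap i j := coord A i @` (dom A i `&` dom A j).

Lemma near_overlap i j x : overlap i j x -> \forall y \near x, overlap i j y.
Proof.
move=> [p [ip jp] px].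
have ix : chart_image i x by exists p.
have : \forall y \near x, dom A j (point A i y).
  by apply: near_point => //; rewrite -px coordK//; exact: near_dom.
move=> h; near=> y; exists (point A i y).
  split; last by near: y.
  by apply: point_dom; near: y; exact: near_chart_image.
by rewrite pointK//; near: y; exact: near_chart_image.
Unshelve. all: by end_near. Qed.

Definition transition i j := coord A j \o point A i.

Lemma transition_component_C1 i j k x : overlap i j x ->
  C1_at (fun y => transition i j y 0 k) x.
Proof.
move=> ox; apply: smooth_on_C1_at ox; last exact: transition_smooth.
by rewrite openE => y oy; exact: near_overlap.
Qed.

Lemma differentiable_rV (f : 'rV[R]_n -> 'rV[R]_n) x :
  (forall k, differentiable (fun y => f y 0 k) x) -> differentiable f x.
Proof.
move=> df.
have -> : f = (fun y => \sum_k (f y 0 k *: delta_mx 0 k)).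
  by apply/funext => y; rewrite [LHS]row_sum_delta.
rewrite (_ : (fun y => _) = \sum_k (fun y => f y 0 k *: delta_mx 0 k)); last first.
  by apply/funext => y; rewrite fct_sumE.
by apply: differentiable_sum => k; exact: differentiableZl.
Qed.

Lemma differentiable_transition i j x : overlap i j x ->
  differentiable (transition i j) x.
Proof.
move=> ox; apply: differentiable_rV => k.
exact: C1_at_differentiable (transition_component_C1 k ox).
Qed.

Definition drow i w p : 'rV[R]_n :=
  \row_b partial b (w \o point A i) (coord A i p).

Lemma drow_change i j p w : dom A i p -> dom A j p ->
  differentiable (w \o point A j) (coord A j p) ->
  drow i w p = drow j w p *m ('J (coord A j \o point A i) (coord A i p))^T.
Proof.
move=> ip jp dw; set x := coord A i p.
have ox : overlap i j x by exists p.
have ix : chart_image i x by exact: chart_image_coord.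
have xj : transition i j x = coord A j p by rewrite /transition /= coordK.
have E : {near x, (w \o point A j) \o transition i j =1 w \o point A i}.
  near=> y; rewrite /transition /= coordK//.
  have [q [iq jq] <-] : overlap i j y by near: y; exact: near_overlap.
  by rewrite coordK.
have dt := differentiable_transition ox.
apply/rowP => a; rewrite !mxE -(near_eq_partial a E) partialE; last first.
  by apply: differentiable_comp; [exact: dt|rewrite xj; exact: dw].
rewrite diff_comp; [|exact: dt|by rewrite xj; exact: dw].
rewrite /= xj.
(* The derivative of the transition map along the [a]-th basis vector is row [a] of its Jacobian;
   the differential of [w] is then expanded linearly over that row. *)
rewrite -[X in 'd _ _ X]mul_rV_lin1 -/(jacobian _ _) -rowE.
rewrite (row_sum_delta (row a _)) linear_sum/=; apply: eq_bigr => k _.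
by rewrite !mxE linearZ/= partialE// mulrC.
Unshelve. all: by end_near. Qed.

End charts.

(** * The gradient form and the Laplacian in local coordinates *)

Section dirichlet_form.
Context {R : realType} {n : nat} {M : ptopologicalType}.
Context {A : smooth_atlas R n M}.
Variable g : riemannian_metric A.
Implicit Types (i j : chart A) (p : M) (u w : M -> R) (x : 'rV[R]_n).
Local Notation metric := (metric g).

Lemma det_metric_gt0 i p : dom A i p -> 0 < \det (metric i p).
Proof. by move=> ip; apply: posdef_det_gt0 => v; exact: metric_pos. Qed.

Lemma metric_unitmx i p : dom A i p -> metric i p \in unitmx.
Proof. by move=> ip; rewrite unitmxE unitfE gt_eqF// det_metric_gt0. Qed.

Lemma volume_density_gt0 i p : dom A i p -> 0 < volume_density g i p.
Proof. by move=> ip; rewrite sqrtr_gt0 det_metric_gt0. Qed.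

Lemma metric_C1 i x a b : chart_image i x ->
  C1_at (fun y => metric i (point A i y) a b) x.
Proof.
move=> ix.
exact: (smooth_on_C1_at (@open_chart_image _ _ _ _ i) (@metric_smooth _ _ _ _ g i a b) ix).
Qed.

Lemma volume_density_C1 i x : chart_image i x ->
  C1_at (volume_density g i \o point A i) x.
Proof.
move=> ix; apply: C1_at_sqrt; last exact/det_metric_gt0/point_dom.
have := C1_at_det (fun a b => metric_C1 a b ix).
congr C1_at; apply/funext => y; congr (\det _).
by apply/matrixP => a b; rewrite mxE.
Qed.

Lemma inverse_metric_C1 i x a b : chart_image i x ->
  C1_at (fun y => invmx (metric i (point A i y)) a b) x.
Proof.
move=> ix; apply: C1_at_invmx => [k l|]; first exact: metric_C1.
by rewrite gt_eqF// det_metric_gt0//; exact: point_dom.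
Qed.

(** The pairing [g^ab d_a u d_b w] of the differentials, that is, the inner product of the two
    gradients computed in the chart [i]. *)
Definition chart_form i u w p : R :=
  (drow i u p *m invmx (metric i p) *m (drow i w p)^T) 0 0.

Definition gradient_form u w p : R := chart_form (chart_at A p) u w p.

Lemma chart_formE i u w p : chart_form i u w p =
  \sum_a gradient g i u p 0 a * partial a (w \o point A i) (coord A i p).
Proof. by rewrite /chart_form mxE; apply: eq_bigr => a _; rewrite !mxE. Qed.

(** Differentials transform by [J^T] and the inverse metric by the inverse factors, so the Jacobians
    cancel. *)
Lemma chart_form_change i j u w p : C1M A u -> C1M A w ->
  dom A i p -> dom A j p -> chart_form i u w p = chart_form j u w p.
Proof.
move=> Cu Cw ip jp; rewrite /chart_form.
rewrite (drow_change ip jp (C1M_differentiable jp Cu)).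
rewrite (drow_change ip jp (C1M_differentiable jp Cw)).
have /= := metric_change g ip jp.
set J := 'J _ _ => gij.
(* Invertibility of the Jacobian is read off from the metric: the factors of the invertible product
   [J g J^T] are invertible. *)
have uJ : J \in unitmx.
  have := metric_unitmx ip; rewrite gij !unitmx_mul.
  by case/andP => /andP[].
have uJT : J^T \in unitmx by rewrite unitmx_tr.
have ug : metric j p \in unitmx := metric_unitmx jp.
have -> : invmx (metric i p) = invmx J^T *m invmx (metric j p) *m invmx J.
  rewrite -[LHS]mulmx1; apply: (can_inj (mulKmx (metric_unitmx ip))).
  rewrite mulmx1 mulmxV; last exact: metric_unitmx.
  by rewrite gij !mulmxA mulmxK// mulmxK// mulmxV.
by rewrite trmx_mul trmxK !mulmxA mulmxK// mulmxKV.
Qed.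

Lemma gradient_formE i u w p : C1M A u -> C1M A w -> dom A i p ->
  gradient_form u w p = chart_form i u w p.
Proof. by move=> Cu Cw ip; apply: chart_form_change => //; exact: chart_atP. Qed.

Lemma sq_norm_gradientE u p : sq_norm_gradient g u p = gradient_form u u p.
Proof.
rewrite /sq_norm_gradient /gradient_form /chart_form /gradient -/(drow _ _ _).
have up := metric_unitmx (chart_atP A p).
by rewrite trmx_mul trmx_inv Defs.metric_sym ?mulmxA ?mulmxKV//; exact: chart_atP.
Qed.

Lemma gradient_C1_near i u x a : smooth A u -> chart_image i x ->
  C1_at (fun y => gradient g i u (point A i y) 0 a) x.
Proof.
move=> su ix.
apply: (@C1_at_near_eq _ _ (fun y => \sum_b partial b (u \o point A i) y *
    invmx (metric i (point A i y)) b a)).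
  near=> y; rewrite /gradient mxE; apply: eq_bigr => b _.
  by rewrite mxE pointK//; near: y; exact: near_chart_image.
apply: C1_at_sum => b _; apply: C1_atM; last exact: inverse_metric_C1.
apply: (smooth_on_C1_at (@open_chart_image _ _ _ _ i) _ ix).
exact: smooth_on_partial (su i).
Unshelve. all: by end_near. Qed.

(** The chart inside [gradient_form] varies with the point, so near [p] the form is first rewritten
    in the single chart chosen at [p]. *)
Lemma continuous_gradient_form u w : C1M A u -> C1M A w ->
  continuous (gradient_form u w).
Proof.
move=> Cu Cw p; pose i := chart_at A p.
have ip : dom A i p := chart_atP A p.
apply: (@near_eq_continuous_for _ _ (chart_form i u w)).
  by near=> q; rewrite (@gradient_formE i)//; near: q; exact: near_dom.
apply: (continuous_at_chart ip).
have ix := chart_image_coord ip.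
apply: (@near_eq_continuous_for _ _ (fun y => \sum_a \sum_b
  (partial b (u \o point A i) y * invmx (metric i (point A i y)) b a *
   partial a (w \o point A i) y))).
  near=> y; rewrite /= chart_formE; apply: eq_bigr => a _.
  have iy : chart_image i y by near: y; exact: near_chart_image.
  rewrite pointK// /gradient mxE mulr_suml; apply: eq_bigr => b _.
  by rewrite mxE pointK.
apply: continuous_for_sum => a; apply: continuous_for_sum => b.
apply: continuousM; last exact: (Cw i _ ix).2.
apply: continuousM; first exact: (Cu i _ ix).2.
exact: C1_at_continuous (inverse_metric_C1 b a ix).
Unshelve. all: by end_near. Qed.

(** The components [|g|^(1/2) g^ab d_b u], whose Euclidean divergence is the volume density times
    the Laplacian. *)
Definition flux i u a x : R :=
  volume_density g i (point A i x) * gradient g i u (point A i x) 0 a.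

Lemma flux_C1 i u a x : smooth A u -> chart_image i x -> C1_at (flux i u a) x.
Proof.
move=> su ix; exact: C1_atM (volume_density_C1 ix) (gradient_C1_near a su ix).
Qed.

(** The Laplacian in a fixed chart, whereas the chart of [laplacian] changes with the point. For
    smooth [u] it is continuous on [dom A i]; its values elsewhere carry no meaning. *)
Definition chart_laplacian i u p : R := divergence g i (gradient g i u) p.

Lemma chart_laplacianE i u x : chart_image i x ->
  volume_density g i (point A i x) * chart_laplacian i u (point A i x) =
  \sum_a partial a (flux i u a) x.
Proof.
move=> ix; rewrite /chart_laplacian /divergence pointK// mulrA mulfV ?mul1r//.
by rewrite gt_eqF// volume_density_gt0//; exact: point_dom.
Qed.

Lemma continuous_chart_laplacian i u p : smooth A u -> dom A i p ->
  {for p, continuous (chart_laplacian i u)}.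
Proof.
move=> su ip; apply: (continuous_at_chart ip).
have ix := chart_image_coord ip.
apply: (@near_eq_continuous_for _ _ (fun y => (volume_density g i (point A i y))^-1 *
   \sum_a partial a (flux i u a) y)).
  near=> y; have iy : chart_image i y by near: y; exact: near_chart_image.
  rewrite -chart_laplacianE// mulrA mulVf ?mul1r//.
  by rewrite gt_eqF// volume_density_gt0//; exact: point_dom.
apply: continuousM.
  apply: continuousV; last exact: C1_at_continuous (volume_density_C1 ix).
  by rewrite gt_eqF// volume_density_gt0//; exact: point_dom.
by apply: continuous_for_sum => a; exact: (flux_C1 a su ix).2.
Unshelve. all: by end_near. Qed.

End dirichlet_form.

(** * Bump functions *)

Section bump.
Context {R : realType}.

(** Squaring the positive part smooths its corner: the derivative is [2 * Num.max 0 t], which is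
    continuous. *)
Definition ramp_sq (t : R) : R := Num.max 0 t ^+ 2.

Lemma ramp_sq_ge0 t : 0 <= ramp_sq t. Proof. exact: sqr_ge0. Qed.

Lemma ramp_sq_le0 t : t <= 0 -> ramp_sq t = 0.
Proof. by move=> t0; rewrite /ramp_sq max_l// expr0n. Qed.

Lemma ramp_sq_ge1 t : 1 <= t -> 1 <= ramp_sq t.
Proof.
by move=> t1; rewrite /ramp_sq max_r ?(le_trans ler01)// exprn_ege1.
Qed.

Lemma ramp_sq_le1 t : t <= 1 -> ramp_sq t <= 1.
Proof.
move=> t1; rewrite /ramp_sq expr_le1// ?le_max ?lexx//.
by rewrite ge_max ler01.
Qed.

Lemma continuous_ramp : continuous (fun t : R => Num.max 0 t).
Proof. by move=> t; apply: continuous_max; [exact: cst_continuous|exact: cvg_id]. Qed.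

Lemma is_derive_ramp_sq (t : R) : is_derive t 1 ramp_sq (2 * Num.max 0 t).
Proof.
have [t0|t0|->] := ltgtP t 0.
- rewrite mulr0; apply: (@near_eq_is_derive _ _ _ (cst 0)).
  + near=> s; rewrite ramp_sq_le0//; apply: ltW; near: s.
    by apply: open_nbhs_nbhs; split => //; exact: open_lt.
- apply: (@near_eq_is_derive _ _ _ ((fun s : R => s ^+ 2) : R -> R)).
  + near=> s; rewrite /ramp_sq max_r//; apply: ltW; near: s.
    by apply: open_nbhs_nbhs; split => //; exact: open_gt.
  + by apply: is_derive_eq; rewrite [t%:A]mulr1 mulrDl mul1r.
- rewrite mulr0.
  (* At 0 the difference quotient is exactly [Num.max 0 h]; for [h = 0] this relies on
     [0^-1 = 0]. *)
  have E : (fun h : R => h^-1 *: ((ramp_sq \o shift 0) (h *: 1) - ramp_sq 0)) =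
      (fun h => Num.max 0 h).
    apply/funext => h /=; rewrite addr0 [h *: 1]mulr1 [ramp_sq 0]ramp_sq_le0// subr0.
    rewrite -[LHS]/(h^-1 * ramp_sq h) /ramp_sq; have [h0|h0] := leP 0 h.
      have [->|h0'] := eqVneq h 0; first by rewrite invr0 mul0r.
      by rewrite expr2 mulrA mulVf// mul1r.
    by rewrite expr0n/= mulr0.
  have c0 : (fun h : R => Num.max 0 h) @ 0^' --> (0 : R).
    apply: cvg_within_filter.
    have : (fun h : R => Num.max 0 h) @ (0 : R) --> Num.max 0 (0 : R).
      exact: (@continuous_ramp 0).
    by rewrite maxxx.
  split; first by rewrite /derivable E; apply/cvg_ex; exists 0.
  by rewrite /derive E; exact: (cvg_lim _ c0).
Unshelve. all: by end_near. Qed.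

Lemma C1_at_ramp_sq n (f : 'rV[R]_n -> R) x :
  C1_at f x -> C1_at (fun y => ramp_sq (f y)) x.
Proof.
move=> Cf; apply: (C1_at_comp Cf).
  by near=> t; case: (is_derive_ramp_sq t).
rewrite (_ : ramp_sq^`()%classic = fun t => 2 * Num.max 0 t); last first.
  by apply/funext => t; rewrite derive1E; case: (is_derive_ramp_sq t).
by apply: continuousM; [exact: cst_continuous|exact: continuous_ramp].
Unshelve. all: by end_near. Qed.

(** Two nested ramps: the inner one reaches 1 at [t = 1], and from there on the outer one vanishes.
    In between the value is [1 - (1 - t^2)^2], which joins 0 to 1 in a C^1 way. *)
Definition step (t : R) : R := 1 - ramp_sq (1 - ramp_sq t).

Lemma step_le0 t : t <= 0 -> step t = 0.
Proof.
by move=> t0; rewrite /step (ramp_sq_le0 t0) subr0 /ramp_sq max_r// expr1n subrr.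
Qed.

Lemma step_ge1 t : 1 <= t -> step t = 1.
Proof.
move=> t1; rewrite /step (@ramp_sq_le0 (1 - _)) ?subr0//.
by rewrite subr_le0 ramp_sq_ge1.
Qed.

Lemma step_ge0 t : 0 <= step t.
Proof. by rewrite subr_ge0 ramp_sq_le1// gerBl ramp_sq_ge0. Qed.

(** A product over the coordinates, adapted to the cubes that are the balls of the sup norm. The
    square avoids an absolute value; the argument of [step] is at most 0 at distance [r] or more and
    at least [3/2] within distance [r / 2]. *)
Definition rV_bump n (c : 'rV[R]_n) (r : R) (y : 'rV[R]_n) : R :=
  \prod_a step (2 - 2 * ((y 0 a - c 0 a) / r) ^+ 2).

Lemma rV_bump_ge0 n (c : 'rV[R]_n) r y : 0 <= rV_bump c r y.
Proof. by apply: prodr_ge0 => a _; exact: step_ge0. Qed.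

Lemma rV_bump_eq0 n (c y : 'rV[R]_n) (r : R) a : 0 < r ->
  r <= `|y 0 a - c 0 a| -> rV_bump c r y = 0.
Proof.
move=> r0 ry; rewrite /rV_bump (bigD1 a)//= step_le0 ?mul0r// subr_le0.
rewrite ler_peMr// -real_normK ?num_real// exprn_ege1//.
by rewrite normrM normfV (gtr0_norm r0) ler_pdivlMr// mul1r.
Qed.

Lemma rV_bump_eq1 n (c y : 'rV[R]_n) (r : R) : 0 < r ->
  (forall a, `|y 0 a - c 0 a| <= r / 2) -> rV_bump c r y = 1.
Proof.
move=> r0 ry; rewrite /rV_bump big1// => a _; apply: step_ge1.
have : `|(y 0 a - c 0 a) / r| <= 1 / 2.
  rewrite normrM normfV (gtr0_norm r0) ler_pdivrMr//.
  by rewrite mul1r mulrC; exact: ry.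
by rewrite ler_norml => /andP[]; set q := _ / r; nra.
Qed.

(** The inner map [f] is there because a bump defined in one chart is read in another one through
    the transition map. *)
Lemma C1_at_rV_bump n (c : 'rV[R]_n) r (f : 'rV[R]_n -> 'rV[R]_n) x :
  (forall a, C1_at (fun y => f y 0 a) x) -> C1_at (fun y => rV_bump c r (f y)) x.
Proof.
move=> Cf; apply: C1_at_prod => a _.
have CB k : C1_at (fun y => f y 0 a + k) x.
  exact: C1_atD (Cf a) (C1_at_cst k x).
apply: C1_at_oneminus; apply: C1_at_ramp_sq; apply: C1_at_oneminus.
apply: C1_at_ramp_sq.
have Cq := C1_atM (CB (- c 0 a)) (C1_at_cst r^-1 x).
have := C1_atD (C1_at_cst 2 x) (C1_atM (C1_at_cst (-2) x) (C1_atM Cq Cq)).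
by congr C1_at; apply/funext => y; rewrite /= expr2 mulNr.
Qed.

End bump.

(** * Bump functions on the manifold supported in one chart *)

Section manifold_bump.
Context {R : realType} {n : nat} {M : ptopologicalType}.
Variable A : smooth_atlas R n M.
Hypothesis M_hausdorff : hausdorff_space M.

(** The bump on R^n is pulled back by the chart and extended by 0. In a Hausdorff space the compact
    set [K] is closed, so the extension vanishes on a neighbourhood of every point outside the chart
    domain and is C^1 there too. *)
Lemma exists_bump (i : chart A) (p : M) (O : set M) : dom A i p -> nbhs p O ->
  exists (psi : M -> R) (K : set M),
    [/\ C1M A psi, compact K, K `<=` dom A i `&` O &
      [/\ forall q, ~ K q -> psi q = 0, forall q, 0 <= psi q &
        \forall q \near p, psi q = 1]].
Proof.
move=> ip pO; set x := coord A i p.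
have ix : chart_image i x := chart_image_coord ip.
have : nbhs x (chart_image i `&` [set y | O (point A i y)]).
  apply: filterI; first exact: near_chart_image.
  by apply: near_point => //; rewrite /x coordK.
move=> /nbhs_ballP[e /= e0 eO].
(* Halving makes the closed cube of radius [r] fit inside the open ball of radius [e]. *)
pose r := e / 2; have r0 : 0 < r by rewrite divr_gt0.
pose Kx := [set y : 'rV[R]_n | forall a, `[x 0 a - r, x 0 a + r]%classic (y ord0 a)].
have cKx : compact Kx.
  apply: (@rV_compact _ _ (fun a => `[x 0 a - r, x 0 a + r]%classic)) => a.
  exact: segment_compact.
have KxO : Kx `<=` chart_image i `&` [set y | O (point A i y)].
  move=> y Ky; apply: eO; split=> // k a; rewrite ord1 /ball/= distrC ltr_distl.
  have := Ky a; rewrite /= in_itv/= => /andP[].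
  by rewrite /r => ? ?; apply/andP; split; lra.
pose K := point A i @` Kx.
have cK : compact K.
  apply: continuous_compact cKx.
  apply: continuous_subspaceW (@point_continuous _ _ _ A i) => y Ky.
  by case: (KxO y Ky).
have clK : closed K by exact: compact_closed.
pose psi q := if `[< dom A i q >] then rV_bump x r (coord A i q) else 0.
have psi0 q : ~ K q -> psi q = 0.
  move=> Kq; rewrite /psi; case: asboolP => // iq.
  have [a qa] : exists a, ~ `[x 0 a - r, x 0 a + r]%classic (coord A i q 0 a).
    apply/existsNP => h; apply: Kq; exists (coord A i q) => //.
    by rewrite coordK.
  apply: (@rV_bump_eq0 _ _ _ _ _ a) => //; rewrite leNgt; apply/negP => h; apply: qa.
  by rewrite /= in_itv/= -ler_distl ltW.
exists psi, K; split => //.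
- move=> j y jy; have [iq|iq] := pselect (dom A i (point A j y)).
    have oy : overlap j i y.
      by exists (point A j y); [split => //; exact: point_dom|rewrite pointK].
    apply: (@C1_at_near_eq _ _ (fun z => rV_bump x r (transition j i z))).
      near=> z; have [q [jq iq'] <-] : overlap j i z by near: z; exact: near_overlap.
      by rewrite /transition /psi /= coordK// asboolT.
    by apply: C1_at_rV_bump => a; exact: transition_component_C1.
  apply: (@C1_at_near_eq _ _ (cst 0)); last exact: C1_at_cst.
  have : \forall q \near point A j y, psi q = 0.
    have : nbhs (point A j y) (~` K).
      apply: open_nbhs_nbhs; split; first exact: closed_openC.
      by move=> [z /KxO[iz _] zq]; apply: iq; rewrite -zq; exact: point_dom.
    by apply: filterS.
  by move/(near_point jy); apply: filterS => z /= ->.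
- by move=> q [y /KxO[iy Oy] <-]; split => //; exact: point_dom.
split => //.
- by move=> q; rewrite /psi; case: asboolP => // _; exact: rV_bump_ge0.
- have : nbhs x [set y : 'rV[R]_n | forall a, `|y 0 a - x 0 a| <= r / 2].
    apply/nbhs_ballP; exists (r / 2) => /=; first by rewrite divr_gt0.
    by move=> y [_ xy] a; have := xy 0 a; rewrite /ball/= distrC => /ltW.
  move/(near_coord ip) => h; near=> q.
  rewrite /psi asboolT; last by near: q; exact: near_dom.
  by apply: rV_bump_eq1 => //; near: q.
Unshelve. all: by end_near. Qed.

End manifold_bump.

(** * The Riemannian measure *)

Section riemannian_integration.
Context {R : realType} {n : nat} {M : ptopologicalType}.
Context {A : smooth_atlas R n M}.
Variables (g : riemannian_metric A) (mu : {measure set (borel M) -> \bar R}).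
Hypothesis mu_riemannian : is_riemannian_measure g mu.
Implicit Types (i j : chart A) (p : M) (u w h : M -> R) (x : 'rV[R]_n).
Local Notation mR := (measurableTypeR R).
Local Notation leb := (lebesgue_tuple R n).
Local Notation rho := (volume_density g).

Lemma open_borel_measurable (U : set M) : open U -> measurable (U : set (borel M)).
Proof. by move=> oU; exact: sub_sigma_algebra. Qed.

Lemma measurable_dom i : measurable (dom A i : set (borel M)).
Proof. by apply: open_borel_measurable; exact: dom_open. Qed.

Lemma measurable_fun_continuous_on (D : set M) h : open D ->
  (forall p, D p -> {for p, continuous h}) ->
  measurable_fun (D : set (borel M)) (h : borel M -> mR).
Proof.
move=> oD ch mD; apply: (measurability _ (RGenOpens.measurableE R)) => //.
move=> _ [_ [a [b ->] <-]]; apply: open_borel_measurable.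
rewrite openE => p [Dp hp]; apply: filterI; first exact: open_nbhs_nbhs.
by apply: ch => //; apply: open_nbhs_nbhs; split => //; exact: interval_open.
Qed.

Definition chart_tuples i : set (n.-tuple mR) :=
  @row_of_tuple R n @^-1` chart_image i.

Definition tuple_point i (t : n.-tuple mR) : borel M := point A i (row_of_tuple t).

Lemma measurable_chart_tuples i : measurable (chart_tuples i).
Proof. by apply: open_measurable_row_of_tuple; exact: open_chart_image. Qed.

Lemma measurable_tuple_point i : measurable_fun (chart_tuples i) (tuple_point i).
Proof.
have borelE : @measurable _ (borel M) = <<s @open M >> by [].
move=> mD; apply: (measurability _ borelE) => //.
move=> _ [U oU <-].
rewrite -[X in measurable X]/(@row_of_tuple R n @^-1`
  (chart_image i `&` point A i @^-1` U)).
apply: open_measurable_row_of_tuple.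
rewrite openE => x [ix Ux]; apply: filterI; first exact: near_chart_image.
by apply: near_point => //; exact: open_nbhs_nbhs.
Qed.

Lemma measurable_density i :
  measurable_fun (chart_tuples i) (fun t => rho i (tuple_point i t)).
Proof.
apply: (@measurable_continuous_row_of_tuple _ _ _ (rho i \o point A i)).
  exact: open_chart_image.
by move=> x ix; exact: C1_at_continuous (volume_density_C1 g ix).
Qed.

Lemma chart_tuples_preimage i (B : set (borel M)) : B `<=` dom A i ->
  @row_of_tuple R n @^-1` (coord A i @` B) =
  chart_tuples i `&` tuple_point i @^-1` B.
Proof.
move=> Bi; apply/seteqP; split => [t /= [p Bp pt]|t [it Bt]].
  split; first by exists p => //; exact: Bi.
  by rewrite /preimage /= /tuple_point -pt coordK//; exact: Bi.
by exists (tuple_point i t) => //; rewrite /tuple_point pointK.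
Qed.

Lemma riemannian_measureE i (B : set (borel M)) : measurable B -> B `<=` dom A i ->
  (mu B = \int[leb]_(t in @row_of_tuple R n @^-1` (coord A i @` B))
    (rho i (tuple_point i t))%:E)%E.
Proof. exact: mu_riemannian. Qed.

Lemma chart_integral i h :
  measurable_fun (dom A i : set (borel M)) (h : borel M -> mR) ->
  (\int[mu]_(p in dom A i) (h p)%:E =
   \int[leb]_(t in chart_tuples i) (h (tuple_point i t) * rho i (tuple_point i t))%:E)%E.
Proof.
move=> mh; apply: integral_transport => //.
- exact: measurable_dom.
- exact: measurable_chart_tuples.
- exact: measurable_tuple_point.
- exact: measurable_density.
- by move=> t it; apply/ltW/volume_density_gt0; exact: point_dom.
- by move=> t it; exact: point_dom.
- by move=> B mB Bi; rewrite (riemannian_measureE mB Bi) chart_tuples_preimage.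
Qed.

(** On a small coordinate ball the density stays between [rho i p / 2] and [rho i p + 1], and the
    ball is a box of volume [(2 e)^n]. Finiteness feeds the covering argument for the total mass;
    positivity turns a positive lower bound on [N] into a positive integral. *)
Lemma small_nbhs p (O : set M) : nbhs p O ->
  exists N : set M, [/\ open N, N p, N `<=` O, (0 < mu N)%E & (mu N < +oo)%E].
Proof.
move=> pO; pose i := chart_at A p; have ip : dom A i p := chart_atP A p.
set x := coord A i p; have ix : chart_image i x := chart_image_coord ip.
have r0 : 0 < rho i p by exact: volume_density_gt0.
have crho : rho i \o point A i @ x --> rho i p.
  have := C1_at_continuous (volume_density_C1 g ix).
  by rewrite /prop_for /continuous_at /= coordK.
have rlow : nbhs (rho i p) [set t | rho i p / 2 < t].
  apply: open_nbhs_nbhs; split; first exact: open_gt.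
  by rewrite /= ltr_pdivrMr// ltr_pMr// ltr1n.
have rupp : nbhs (rho i p) [set t | t < rho i p + 1].
  by apply: open_nbhs_nbhs; split; [exact: open_lt|rewrite /= ltrDl].
have : nbhs x [set y | [/\ chart_image i y, O (point A i y),
    rho i p / 2 < rho i (point A i y) & rho i (point A i y) < rho i p + 1]].
  near=> y; split.
  - by near: y; exact: near_chart_image.
  - by near: y; apply: near_point => //; rewrite /x coordK.
  - by near: y; exact: crho _ rlow.
  - by near: y; exact: crho _ rupp.
move=> /nbhs_ballP[e /= e0 eO].
pose N := dom A i `&` coord A i @^-1` (ball x e).
have oN : open N.
  rewrite openE => q [iq xq]; apply: filterI; first exact: near_dom.
  by apply: near_coord => //; apply: open_nbhs_nbhs; split => //; exact: ball_open.
have NE : coord A i @` N = ball x e.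
  apply/seteqP; split => [_ [q [_ ?] <-]//|y xy].
  have [iy _ _ _] := eO y xy.
  by exists (point A i y); rewrite ?pointK//; split; rewrite /= ?pointK//; exact: point_dom.
pose S := tuple_box (fun a => `]x 0 a - e, x 0 a + e[%classic : set R).
have SE : @row_of_tuple R n @^-1` (ball x e) = S.
  by apply/seteqP; split => t /rV_ball_box => /(_ e0).
have mS : measurable S by apply: measurable_tuple_box => a; exact: measurable_itv.
have lS : leb S = (\prod_(a < n) (2 * e))%:E.
  rewrite lebesgue_tuple_box; last by move=> a; exact: measurable_itv.
  rewrite -prodEFin; apply: eq_bigr => a _; rewrite lebesgue_measure_itv/= lte_fin.
  rewrite ltrD2l gt0_cp//; congr (_%:E); ring.
have muN : mu N = (\int[leb]_(t in S) (rho i (tuple_point i t))%:E)%E.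
  rewrite (@riemannian_measureE i) ?NE ?SE//; last by move=> ? [].
  exact: open_borel_measurable.
have Srho t : S t -> rho i p / 2 < rho i (tuple_point i t) < rho i p + 1.
  rewrite -SE => /eO[_ _ ? ?]; exact/andP.
have mrho : measurable_fun S (fun t => (rho i (tuple_point i t))%:E).
  apply/measurable_EFinP.
  apply: (@measurable_funS _ _ _ _ (chart_tuples i)) => //.
  - exact: measurable_chart_tuples.
  - by rewrite -SE => t /eO[].
  - exact: measurable_density.
exists N; split => //.
- by split => //; exact: ballxx.
- by move=> q [iq /eO[_]]; rewrite coordK.
- rewrite muN; apply: (@lt_le_trans _ _ ((rho i p / 2)%:E * leb S)%E).
    by rewrite lS -EFinM lte_fin mulr_gt0 ?divr_gt0// prodr_gt0// => a _; rewrite mulr_gt0.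
  rewrite -integral_cst//; apply: ge0_le_integral => //.
  + by move=> t St; rewrite lee_fin ltW// divr_gt0.
  + by move=> t /Srho/andP[h _]; rewrite lee_fin ltW.
- rewrite muN; apply: (@le_lt_trans _ _ ((rho i p + 1)%:E * leb S)%E).
    rewrite -integral_cst//; apply: ge0_le_integral => //.
    + by move=> t /Srho/andP[h _]; rewrite lee_fin ltW// (lt_trans _ h)// divr_gt0.
    + by move=> t /Srho/andP[_ h]; rewrite lee_fin ltW.
  by rewrite lS -EFinM ltry.
Unshelve. all: by end_near. Qed.

Hypothesis M_compact : compact [set: M].

Lemma riemannian_measure_lty : (mu setT < +oo)%E.
Proof.
have H p : exists N : set M, [/\ open N, N p & (mu N < +oo)%E].
  by have [N [? ? _ _ ?]] := small_nbhs (@filterT _ (nbhs p) _); exists N.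
have [N HN] := choice H.
move: M_compact; rewrite compact_cover => /(_ M setT N)[].
- by move=> p _; case: (HN p).
- by move=> p _; exists p => //; case: (HN p).
move=> D _ DN.
have DE : [set: M] = \big[setU/set0]_(p <- finmap.enum_fset D) N p.
  rewrite -bigcup_fset; apply/esym; rewrite -subTset => p /DN[q qD Nq].
  by exists q.
have mN p : measurable (N p : set (borel M)).
  by apply: open_borel_measurable; case: (HN p).
rewrite [X in mu X]DE; elim: (finmap.enum_fset D) => [|p s IH].
  by rewrite big_nil measure0.
rewrite big_cons; apply: (le_lt_trans (measureU2 _ _ _)) => //.
  by apply: bigsetU_measurable => q _.
by apply: lte_add_pinfty => //; case: (HN p).
Qed.

Lemma continuous_integrable h : continuous h ->
  mu.-integrable setT (EFin \o (h : borel M -> R)).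
Proof.
move=> ch; apply: measurable_bounded_integrable => //.
- exact: riemannian_measure_lty.
- by apply: measurable_fun_continuous_on => [|p _]; [exact: openT|exact: ch].
- have /compact_bounded[C [_ HC]] : compact (h @` [set: M]).
    by apply: continuous_compact M_compact; exact: continuous_subspaceT.
  exists C; split; first exact: num_real.
  by move=> y Cy p _; apply: HC Cy _ _; exists p.
Qed.

End riemannian_integration.

(** * Green's formula *)

Section green.
Context {R : realType} {n : nat} {M : ptopologicalType}.
Context {A : smooth_atlas R n M}.
Variables (g : riemannian_metric A) (mu : {measure set (borel M) -> \bar R}).
Hypothesis M_hausdorff : hausdorff_space M.
Hypothesis M_compact : compact [set: M].
Hypothesis mu_riemannian : is_riemannian_measure g mu.
Implicit Types (i j : chart A) (p : M) (u w h : M -> R) (x : 'rV[R]_n).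
Local Notation mR := (measurableTypeR R).
Local Notation leb := (lebesgue_tuple R n).
Local Notation rho := (volume_density g).
Local Notation form := (gradient_form g).
Local Notation lap := (chart_laplacian g).

Section compactly_supported.
Variables (i : chart A) (u W : M -> R) (K : set M).
Hypotheses (su : smooth A u) (CW : C1M A W).
Hypotheses (cK : compact K) (Ki : K `<=` dom A i) (WK : forall q, ~ K q -> W q = 0).

Lemma near_notin_support q : ~ K q -> \forall q' \near q, ~ K q'.
Proof.
move=> Kq; apply: open_nbhs_nbhs; split => //.
by apply: closed_openC; exact: compact_closed.
Qed.

Lemma gradient_form_notin_support q : ~ K q -> form u W q = 0.
Proof.
move=> Kq; rewrite /gradient_form chart_formE big1// => a _.
have jq := chart_image_coord (chart_atP A q).
have E : {near coord A (chart_at A q) q, W \o point A (chart_at A q) =1 cst 0}.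
  have : \forall q' \near point A (chart_at A q) (coord A (chart_at A q) q), W q' = 0.
    rewrite coordK; last exact: chart_atP.
    by apply: filterS (near_notin_support Kq) => q'; exact: WK.
  exact: near_point.
by rewrite (near_eq_partial a E) /partial derive_cst mulr0.
Qed.

(** [lap i u] is controlled only on [dom A i]; at any other point [W] vanishes nearby and the
    integrand is locally 0. *)
Lemma continuous_green_integrand : continuous (fun p => form u W p + W p * lap i u p).
Proof.
move=> p; have [ip|ip] := pselect (dom A i p).
  apply: (@continuousD _ _ _ (form u W)).
    exact: (continuous_gradient_form (smooth_C1M su) CW).
  apply: (@continuousM _ _ W); first exact: C1M_continuous CW _.
  exact: continuous_chart_laplacian.
have Kp : ~ K p by move=> /Ki.
apply: (@near_eq_continuous_for _ _ (cst 0)); last exact: cst_continuous.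
apply: filterS (near_notin_support Kp) => q Kq.
by rewrite gradient_form_notin_support// WK// mul0r addr0.
Qed.

(** Coordinates of the field [W grad u] weighted by the volume density. The extension by 0 is
    explicit because [point A i] is arbitrary off the chart image. *)
Let F a x : R :=
  if `[< chart_image i x >] then W (point A i x) * flux g i u a x else 0.

Let Kc : set 'rV[R]_n := coord A i @` K.

Let compact_Kc : compact Kc.
Proof.
apply: continuous_compact cK.
exact: continuous_subspaceW (@Defs.coord_continuous _ _ _ A i).
Qed.

Let F_Kc a x : ~ Kc x -> F a x = 0.
Proof.
move=> Kx; rewrite /F; case: asboolP => // ix; rewrite WK ?mul0r// => KP.
by apply: Kx; exists (point A i x) => //; rewrite pointK.
Qed.

Let F_near a x : chart_image i x ->
  {near x, (fun y => W (point A i y) * flux g i u a y) =1 F a}.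
Proof.
by move=> ix; apply: filterS (near_chart_image ix) => y iy; rewrite /F asboolT.
Qed.

(** The image [Kc] of the support is compact, hence closed, so a point off the chart image has a
    whole neighbourhood avoiding it. This gives regularity across the boundary of the chart
    image. *)
Let F_near0 a x : ~ chart_image i x -> {near x, cst 0 =1 F a}.
Proof.
move=> ix; have : nbhs x (~` Kc).
  apply: open_nbhs_nbhs; split.
    by apply: closed_openC; apply: compact_closed => //; exact: norm_hausdorff.
  by move=> [q /Ki iq qx]; apply: ix; exists q.
by apply: filterS => y /F_Kc ->.
Qed.

Let F_C1 a x : C1_at (F a) x.
Proof.
have [ix|ix] := pselect (chart_image i x).
  apply: C1_at_near_eq (F_near a ix) _.
  exact: C1_atM (CW ix) (flux_C1 g a su ix).
exact: C1_at_near_eq (F_near0 a ix) (C1_at_cst 0 x).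
Qed.

Let F_supported : exists r, forall a, cube_supported r (F a).
Proof.
have [C [_ HC]] := compact_bounded compact_Kc.
exists (C + 1) => a x k xk; apply: F_Kc => Kx.
have : `|x| <= C + 1 by apply: HC; [rewrite ltrDl|].
apply/negP; rewrite -ltNge (lt_le_trans xk)//.
by rewrite [leRHS]/Num.norm/= mx_normrE; exact: (le_bigmax _ _ (0, k)).
Qed.

(** Leibniz rule: the derivatives of [W] produce the gradient form and those of the flux the
    Laplacian, both weighted by the density. *)
Let F_partial x : \sum_a partial a (F a) x =
  if `[< chart_image i x >] then
    (form u W (point A i x) + W (point A i x) * lap i u (point A i x)) *
      rho i (point A i x)
  else 0.
Proof.
case: asboolP => ix; last first.
  by apply: big1 => a _; rewrite -(near_eq_partial a (F_near0 a ix)) /partial derive_cst.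
have ip := point_dom ix.
rewrite (gradient_formE g (smooth_C1M su) CW ip) chart_formE pointK//.
rewrite mulrDl -mulrA [lap _ _ _ * _]mulrC chart_laplacianE// mulr_suml mulr_sumr.
rewrite -big_split/=; apply: eq_bigr => a _.
rewrite -(near_eq_partial a (F_near a ix)) {1}/partial.
have dW : derivable (W \o point A i) x (delta_mx 0 a).
  by apply: diff_derivable; exact: C1_at_differentiable (CW ix).
have dfl : derivable (flux g i u a) x (delta_mx 0 a).
  by apply: diff_derivable; exact: C1_at_differentiable (flux_C1 g a su ix).
have /= -> := deriveM dW dfl.
rewrite addrC; congr (_ + _).
by rewrite -[LHS]/(flux g i u a x * partial a (W \o point A i) x) /flux; ring.
Qed.

Lemma green_chart : (\int[mu]_p (form u W p + W p * lap i u p)%:E = 0)%E.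
Proof.
pose h p := form u W p + W p * lap i u p.
transitivity (\int[mu]_(p in dom A i) (h p)%:E)%E.
  rewrite [RHS]integral_mkcond; apply: eq_integral => p _.
  rewrite /patch; case: ifPn => //; rewrite notin_setE => ip.
  have Kp : ~ K p by move=> /Ki.
  by rewrite /h gradient_form_notin_support// WK// mul0r addr0.
rewrite (chart_integral mu_riemannian); last first.
  apply: measurable_fun_continuous_on; first exact: dom_open.
  by move=> p _; exact: continuous_green_integrand.
transitivity (\int[leb]_t (\sum_a partial a (F a) (row_of_tuple t))%:E)%E.
  rewrite integral_mkcond; apply: eq_integral => t _.
  rewrite F_partial /patch /chart_tuples.
  by case: ifPn; rewrite ?inE ?notin_setE /= => it; [rewrite asboolT|rewrite asboolF].
have [r Fr] := F_supported.
have cdF a : continuous (partial a (F a)) by move=> x; exact: (F_C1 a x).2.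
under eq_integral do rewrite -sumEFin.
rewrite integral_sum//.
  by rewrite big1// => a _; apply: integral_partial_eq0 (Fr a) => x; exact: F_C1.
move=> a; apply: cube_supported_integrable (cdF a) _.
exact: cube_supported_partial.
Qed.

End compactly_supported.
End green.

(** * Chart independence of the Laplacian and the weak eigenvalue equation *)

Section eigenfunctions.
Context {R : realType} {n : nat} {M : ptopologicalType}.
Context {A : smooth_atlas R n M}.
Variables (g : riemannian_metric A) (mu : {measure set (borel M) -> \bar R}).
Hypothesis M_hausdorff : hausdorff_space M.
Hypothesis M_compact : compact [set: M].
Hypothesis mu_riemannian : is_riemannian_measure g mu.
Implicit Types (i j : chart A) (p : M) (u w h : M -> R) (x : 'rV[R]_n).
Local Notation form := (gradient_form g).
Local Notation lap := (chart_laplacian g).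
Local Notation integrable_continuous := (continuous_integrable mu_riemannian M_compact).

Lemma Rintegral_green i u W (K : set M) : smooth A u -> C1M A W ->
  compact K -> K `<=` dom A i -> (forall q, ~ K q -> W q = 0) ->
  \int[mu]_p (form u W p + W p * lap i u p) = 0.
Proof.
move=> su CW cK Ki WK.
by rewrite /Rintegral (green_chart M_hausdorff mu_riemannian su CW cK Ki WK).
Qed.

(* Green's formula in both charts, tested against a bump function supported
   where the two expressions differ; this replaces the direct computation with
   the derivatives of the Jacobian determinant. *)
Lemma chart_laplacian_le i j u p : smooth A u -> dom A i p -> dom A j p ->
  lap i u p <= lap j u p.
Proof.
move=> su ip jp; rewrite leNgt; apply/negP => lt_ji.
pose D q := lap i u q - lap j u q.
have D0 : 0 < D p by rewrite subr_gt0.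
have cD : {for p, continuous D}.
  apply: (@continuousB _ _ _ (lap i u) (lap j u)).
    exact: continuous_chart_laplacian.
  exact: continuous_chart_laplacian.
have cDp : D @ p --> D p := cD.
have low : nbhs (D p) [set t | D p / 2 < t].
  apply: open_nbhs_nbhs; split; first exact: open_gt.
  by rewrite /= ltr_pdivrMr// ltr_pMr// ltr1n.
have pO : nbhs p (dom A j `&` [set q | D p / 2 < D q]).
  by apply: filterI; [exact: near_dom|exact: cDp _ low].
have [W [K [CW cK KO [WK W0 W1]]]] := exists_bump M_hausdorff ip pO.
have Ki : K `<=` dom A i by move=> q /KO[].
have Kj : K `<=` dom A j by move=> q /KO[_ []].
have Gi := Rintegral_green su CW cK Ki WK.
have Gj := Rintegral_green su CW cK Kj WK.
have ci : continuous (fun q => form u W q + W q * lap i u q).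
  by move=> q; exact: (continuous_green_integrand M_hausdorff su CW cK Ki WK).
have cj : continuous (fun q => form u W q + W q * lap j u q).
  by move=> q; exact: (continuous_green_integrand M_hausdorff su CW cK Kj WK).
have WD0 : \int[mu]_q (W q * D q) = 0.
  rewrite -[RHS](subrr 0) -{1}Gi -Gj -RintegralB//.
  - by apply: eq_Rintegral => q _; rewrite /D; ring.
  - exact: integrable_continuous ci.
  - exact: integrable_continuous cj.
have iWD : mu.-integrable setT (EFin \o ((fun q => W q * D q) : borel M -> R)).
  rewrite (_ : (fun q => _) = (fun q => (form u W q + W q * lap i u q) -
      (form u W q + W q * lap j u q))); last first.
    by apply/funext => q; rewrite /D; ring.
  apply: integrable_continuous => q.
  by apply: (@continuousB _ _ _ (fun q => form u W q + W q * lap i u q));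
    [exact: ci|exact: cj].
have [N [oN Np NO N0 Noo]] := small_nbhs mu_riemannian (filterI pO W1).
have mN : measurable (N : set (borel M)) by exact: open_borel_measurable.
(* [W * D] is at least [D p / 2] on [N], where [W] is 1, and nonnegative elsewhere because [D] is
   positive on [K]; its integral therefore cannot be 0. *)
have : D p / 2 * fine (mu N) <= \int[mu]_q (W q * D q).
  rewrite -(@Rintegral_cst _ _ _ mu N mN) Rintegral_mkcond.
  apply: le_Rintegral => //.
    apply: (@integrable_bounded_supported _ _ _ mu N
      ((cst (D p / 2) : borel M -> R) \_ N) (D p)) => //.
    - apply/(measurable_restrictT _ _).1 => //.
    - move=> q; rewrite /patch; case: ifP => _; rewrite ?normr0 ?ltW//.
      rewrite ger0_norm ?divr_ge0 ?ltW//.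
      by rewrite ltr_pdivrMr// ltr_pMr// ltr1n.
    - by move=> q Nq; rewrite /patch memNset.
  move=> q _; rewrite /patch; case: ifPn => [|_].
    by rewrite inE => /NO[[_ /= Dq] Wq]; rewrite /cst Wq mul1r ltW.
  have [Kq|Kq] := pselect (K q); last by rewrite WK// mul0r.
  apply: mulr_ge0; first exact: W0.
  have [_ [_ /= Dq]] := KO q Kq; apply: ltW; apply: lt_trans Dq.
  by rewrite divr_gt0.
rewrite WD0 leNgt mulr_gt0// ?divr_gt0// fine_gt0//.
by rewrite N0 Noo.
Qed.

Lemma chart_laplacian_change i j u p : smooth A u -> dom A i p -> dom A j p ->
  lap i u p = lap j u p.
Proof.
by move=> su ip jp; apply/eqP; rewrite eq_le !chart_laplacian_le.
Qed.

Section weak_formulation.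
Variables (lambda : R) (u : M -> R).
Hypothesis u_eigen : laplace_eigenspace g lambda u.

Let su : smooth A u. Proof. by case: u_eigen. Qed.
Let Cu : C1M A u. Proof. exact: smooth_C1M. Qed.

Definition weak_residual w := \int[mu]_p (form u w p - lambda * (u p * w p)).

Let continuous_integrand w : C1M A w ->
  continuous (fun p => form u w p - lambda * (u p * w p)).
Proof.
move=> Cw p; apply: (@continuousB _ _ _ (form u w)).
  exact: continuous_gradient_form.
apply: (@continuousM _ _ (cst lambda)); first exact: cst_continuous.
by apply: (@continuousM _ _ u); [exact: C1M_continuous Cu p|exact: C1M_continuous Cw p].
Qed.

Let weak_residual_local i W (K : set M) : C1M A W ->
  compact K -> K `<=` dom A i -> (forall q, ~ K q -> W q = 0) ->
  weak_residual W = 0.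
Proof.
move=> CW cK Ki WK; rewrite -(Rintegral_green su CW cK Ki WK).
apply: eq_Rintegral => q _; congr (_ + _).
have [Kq|Kq] := pselect (K q); last by rewrite WK// !(mulr0, mul0r) oppr0.
(* The eigenvalue equation is given in the chart [chart_at A q], Green's formula in the chart
   [i]. *)
rewrite (chart_laplacian_change su (Ki _ Kq) (chart_atP A q)).
have -> : lap (chart_at A q) u q = - lambda * u q by case: u_eigen => _; exact.
ring.
Qed.

Lemma gradient_formD w1 w2 p : C1M A w1 -> C1M A w2 ->
  form u (fun q => w1 q + w2 q) p = form u w1 p + form u w2 p.
Proof.
move=> C1 C2; rewrite /gradient_form !chart_formE -big_split/=.
apply: eq_bigr => a _; rewrite -mulrDr; congr (_ * _).
have jp := chart_atP A p.
have d1 : derivable (w1 \o point A (chart_at A p)) (coord A (chart_at A p) p) (delta_mx 0 a).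
  by apply: diff_derivable; exact: C1M_differentiable.
have d2 : derivable (w2 \o point A (chart_at A p)) (coord A (chart_at A p) p) (delta_mx 0 a).
  by apply: diff_derivable; exact: C1M_differentiable.
exact: deriveD d1 d2.
Qed.

Let weak_residualD w1 w2 : C1M A w1 -> C1M A w2 ->
  weak_residual (fun q => w1 q + w2 q) = weak_residual w1 + weak_residual w2.
Proof.
move=> C1 C2; rewrite /weak_residual -RintegralD//.
- by apply: eq_Rintegral => q _; rewrite gradient_formD//; ring.
- by apply: integrable_continuous; exact: continuous_integrand.
- by apply: integrable_continuous; exact: continuous_integrand.
Qed.

(* Multiplying [w] by [1 - psi q], where [psi q] is a bump function at [q],
   changes it by a function supported in one chart; finitely many such factors
   have product zero. *)
Lemma weak_residual_eq0 w : C1M A w -> weak_residual w = 0.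
Proof.
have H p : exists (psi : M -> R) (K N : set M), [/\ C1M A psi, compact K,
    K `<=` dom A (chart_at A p), (forall q, ~ K q -> psi q = 0) &
    [/\ open N, N p & forall q, N q -> psi q = 1]].
  have [psi [K [C cK KO [K0 _ near1]]]] :=
    exists_bump M_hausdorff (chart_atP A p) (@filterT _ (nbhs p) _).
  have : nbhs p [set q | psi q = 1] := near1.
  rewrite nbhsE => -[N [oN Np] N1].
  by exists psi, K, N; split => // q /KO[].
have [psi Hpsi] := choice H; have [K HK] := choice Hpsi; have [N HN] := choice HK.
have Cpsi p : C1M A (psi p) by case: (HN p).
pose P (s : seq M) q := \prod_(p <- s) (1 - psi p q).
have weakP s w' : C1M A w' -> weak_residual w' = weak_residual (fun q => P s q * w' q).
  elim: s w' => [|p s IH] w' Cw'.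
    by congr weak_residual; apply/funext => q; rewrite /P big_nil mul1r.
  have [_ cK Ki K0 _] := HN p.
  have C1 : C1M A (fun q => psi p q * w' q) by exact: C1MM (Cpsi p) Cw'.
  have C2 : C1M A (fun q => (1 - psi p q) * w' q).
    exact: C1MM (C1M_oneminus (Cpsi p)) Cw'.
  rewrite (_ : w' = fun q => psi p q * w' q + (1 - psi p q) * w' q); last first.
    by apply/funext => q; ring.
  rewrite weak_residualD// (weak_residual_local C1 cK Ki) ?add0r; last first.
    by move=> q Kq; rewrite K0// mul0r.
  rewrite IH//; congr weak_residual; apply/funext => q.
  by rewrite /P big_cons; ring.
move=> Cw.
move: M_compact; rewrite compact_cover => /(_ M setT N)[].
- by move=> p _; case: (HN p) => _ _ _ _ [].
- by move=> p _; exists p => //; case: (HN p) => _ _ _ _ [].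
move=> F _ FN; rewrite (weakP (finmap.enum_fset F) w Cw).
have -> : (fun q => P (finmap.enum_fset F) q * w q) = cst 0.
  apply/funext => q; have [p pF Npq] := FN q Logic.I.
  rewrite /P (big_rem p)//=; case: (HN p) => _ _ _ _ [_ _ ->//].
  by rewrite subrr !mul0r.
rewrite /weak_residual (_ : (fun p => _) = cst 0); first by rewrite Rintegral_cst// mul0r.
apply/funext => q; rewrite mulr0 mulr0 subr0 /gradient_form chart_formE big1// => a _.
by rewrite /partial derive_cst mulr0.
Qed.

(** Testing with the constant 1 kills the gradient term and leaves [- lambda] times the integral of
    [u]. *)
Lemma eigenfunction_mean : lambda != 0 -> \int[mu]_p u p = 0.
Proof.
move=> l0; have := weak_residual_eq0 (C1M_cst 1).
rewrite /weak_residual (_ : (fun p => _) = fun p => - lambda * u p); last first.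
  apply/funext => q; rewrite mulr1 mulNr /gradient_form chart_formE big1 ?sub0r// => a _.
  by rewrite /partial derive_cst mulr0.
rewrite RintegralZl//; last first.
  by apply: integrable_continuous => p; exact: (C1M_continuous Cu).
by move/eqP; rewrite mulf_eq0 oppr_eq0 (negbTE l0) => /eqP.
Qed.

Lemma eigenfunction_energy :
  \int[mu]_p sq_norm_gradient g u p = lambda * \int[mu]_p (u p ^+ 2).
Proof.
have := weak_residual_eq0 Cu; rewrite /weak_residual RintegralB//.
- move/eqP; rewrite subr_eq0 => /eqP E.
  transitivity (\int[mu]_p form u u p).
    by apply: eq_Rintegral => p _; exact: sq_norm_gradientE.
  rewrite E -RintegralZl//.
  by apply: integrable_continuous => p; exact: (C1M_continuous (C1MM Cu Cu)).
- by apply: integrable_continuous => p; exact: (continuous_gradient_form Cu Cu).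
- apply: integrable_continuous => p.
  exact: (C1M_continuous (C1MM (C1M_cst lambda) (C1MM Cu Cu))).
Qed.

End weak_formulation.
End eigenfunctions.

(** * The shifted eigenfunction *)

Section shifted_competitor.
Context {R : realType} {n : nat} {M : ptopologicalType}.
Context {A : smooth_atlas R n M}.
Variables (g : riemannian_metric A) (mu : {measure set (borel M) -> \bar R}).
Implicit Types (p : M) (u w f : M -> R) (c : R).

Lemma partial_subr_cst (F : 'rV[R]_n -> R) c a :
  partial a (fun x => F x - c) = partial a F.
Proof.
apply/funext => x; rewrite /partial /derive.
rewrite [X in lim (X @ _)](_ : _ =
    fun h : R => h^-1 *: ((F \o shift x) (h *: delta_mx 0 a) - F x))//.
by apply/funext => h /=; rewrite opprB addrA subrK.
Qed.

Lemma smooth_subr_cst u c : smooth A u -> smooth A (fun p => u p - c).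
Proof.
(* The derivative applied first is the last element of the list; if there is one, it already removes
   the constant. *)
move=> su i s x ix; case/lastP: s => [|s a].
  apply: differentiableB; last exact: differentiable_cst.
  exact: (su i [::]).
have := su i (rcons s a) x ix; rewrite /iter_partial !foldr_rcons.
by rewrite (@partial_subr_cst (u \o point A i) c a).
Qed.

Lemma gradient_subr_cst i u c p :
  gradient g i (fun q => u q - c) p = gradient g i u p.
Proof.
rewrite /gradient; congr (_ *m _); apply/rowP => b; rewrite !mxE.
by rewrite (@partial_subr_cst (u \o point A i) c b).
Qed.

Lemma sq_norm_gradient_subr_cst u c p :
  sq_norm_gradient g (fun q => u q - c) p = sq_norm_gradient g u p.
Proof. by rewrite /sq_norm_gradient gradient_subr_cst. Qed.

Lemma laplacian_cst c p : laplacian g (cst c) p = 0.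
Proof.
have grad0 i q : gradient g i (cst c) q = 0.
  rewrite /gradient (_ : \row_b _ = 0) ?mul0mx//.
  by apply/rowP => b; rewrite !mxE /partial (derive_cst c).
rewrite /laplacian /divergence big1 ?mulr0// => a _.
rewrite (_ : (fun x => _) = cst 0); first by rewrite /partial derive_cst.
by apply/funext => x; rewrite grad0 mxE mulr0.
Qed.

(** A constant has zero Laplacian, so with [lambda != 0] a constant eigenfunction would be 0. This
    makes the shifted eigenfunction an admissible, nonzero competitor. *)
Lemma eigenfunction_nonconstant lambda u c : lambda != 0 ->
  laplace_eigenspace g lambda u -> (exists p, u p != 0) ->
  exists p, u p - c != 0.
Proof.
move=> l0 [_ lu] [p up]; apply/not_existsP => H.
have uE : u = cst c.
  by apply/funext => q; apply/eqP; rewrite -subr_eq0; apply/negPn/negP; exact: H.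
have := lu p; rewrite [in laplacian _ _]uE laplacian_cst => /esym/eqP.
by rewrite mulf_eq0 oppr_eq0 (negbTE l0) (negbTE up).
Qed.

Hypothesis M_hausdorff : hausdorff_space M.
Hypothesis M_compact : compact [set: M].
Hypothesis mu_riemannian : is_riemannian_measure g mu.
Let vol := fine (mu setT).

Lemma C1M_integrable w : C1M A w -> mu.-integrable setT (EFin \o (w : borel M -> R)).
Proof.
by move=> Cw; apply: (continuous_integrable mu_riemannian M_compact) => p;
  exact: (C1M_continuous Cw).
Qed.

Lemma volume_gt0 : 0 < vol.
Proof.
have [N [oN _ _ N0 _]] := small_nbhs mu_riemannian
  (@filterT _ (nbhs (classical_sets.point : M)) _).
apply: fine_gt0; rewrite (riemannian_measure_lty mu_riemannian M_compact) andbT.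
apply: (lt_le_trans N0); apply: le_measure; rewrite ?inE//.
exact: open_borel_measurable.
Qed.

(** [u] is bounded on the compact manifold. The estimate serves for the quotient that defines the
    shift: if its denominator is 0, then so is its numerator. *)
Lemma Rintegral_mul_le u f : C1M A u -> C1M A f -> (forall p, 0 < f p) ->
  exists C, `|\int[mu]_p (f p * u p)| <= C * \int[mu]_p f p.
Proof.
move=> Cu Cf f0.
have /compact_bounded[C [_ HC]] : compact (u @` [set: M]).
  apply: continuous_compact M_compact; apply: continuous_subspaceT => p.
  exact: (C1M_continuous Cu).
have uC p : `|u p| <= C + 1 by apply: HC; [rewrite ltrDl|exists p].
have ifu := C1M_integrable (C1MM Cf Cu).
exists (C + 1); rewrite -RintegralZl//; last exact: C1M_integrable.
apply: (le_trans (le_normr_Rintegral _ ifu)) => //.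
apply: le_Rintegral => //.
- exact: (integrable_norm ifu).
- exact: (C1M_integrable (C1MM (C1M_cst (C + 1)) Cf)).
- by move=> p _; rewrite normrM (gtr0_norm (f0 p)) mulrC ler_wpM2r// ltW.
Qed.

Lemma rayleigh_subr_cst lambda u c : lambda != 0 ->
  laplace_eigenspace g lambda u ->
  rayleigh g mu (fun p => u p - c) =
  lambda * \int[mu]_p (u p ^+ 2) / (\int[mu]_p (u p ^+ 2) + c ^+ 2 * vol).
Proof.
move=> l0 ul; rewrite /rayleigh; congr (_ / _).
  rewrite -(eigenfunction_energy M_hausdorff M_compact mu_riemannian ul).
  by apply: eq_Rintegral => p _; exact: sq_norm_gradient_subr_cst.
have Cu : C1M A u by apply: smooth_C1M; case: ul.
have mean := eigenfunction_mean M_hausdorff M_compact mu_riemannian ul l0.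
have iu2 := C1M_integrable (C1MM Cu Cu).
have icu := C1M_integrable (C1MM (C1M_cst (- (2 * c))) Cu).
have ic := C1M_integrable (C1M_cst (c ^+ 2)).
transitivity (\int[mu]_p ((u p * u p + - (2 * c) * u p) + c ^+ 2)).
  by apply: eq_Rintegral => p _; ring.
rewrite RintegralD//; last first.
  have := integrableD measurableT iu2 icu.
  by apply: eq_integrable => // p _; rewrite /= EFinD.
rewrite RintegralD// RintegralZl//; last exact: C1M_integrable.
by rewrite mean mulr0 addr0 Rintegral_cst// setTI.
Qed.

Lemma lambda1_of_le_rayleigh lambda u f : 0 < lambda ->
  laplace_eigenspace g lambda u -> (exists p, u p != 0) ->
  C1M A f -> (forall p, 0 < f p) ->
  (lambda1_of g mu f <= (rayleigh g mu (fun p =>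
    (u p - \int[mu]_p (f p * u p) / \int[mu]_p f p)%R))%:E)%E.
Proof.
move=> l0 ul u0 Cf f0; set c := (_ / _)%R.
have su : smooth A u by case: ul.
have Cu : C1M A u := smooth_C1M su.
apply: ereal_inf_lbound; exists (fun p => u p - c) => //; split.
- exact: smooth_subr_cst.
- exact: eigenfunction_nonconstant (lt0r_neq0 l0) ul u0.
rewrite /L2_orthogonal.
transitivity (\int[mu]_p (f p * u p - c * f p)).
  by apply: eq_Rintegral => p _; rewrite mulrBr [f p * c]mulrC.
rewrite RintegralB//; last 2 first.
- exact: (C1M_integrable (C1MM Cf Cu)).
- exact: (C1M_integrable (C1MM (C1M_cst c) Cf)).
rewrite RintegralZl//; last exact: C1M_integrable.
(* Division by 0 gives 0, so in the degenerate case the shift [c] is 0, and orthogonality holds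
   because the integral of [f * u] vanishes with that of [f]. *)
have [If0|If0] := eqVneq (\int[mu]_p f p) 0; last by rewrite divfK// subrr.
have [C] := Rintegral_mul_le Cu Cf f0.
by rewrite If0 !mulr0 subr0 normr_le0 => /eqP.
Qed.

End shifted_competitor.

(** * The weak and the strict inequality *)

Lemma ratio_le (R : realFieldType) (l a k : R) : 0 < l -> 0 <= a -> 0 <= k ->
  l * a / (a + k) <= l.
Proof.
(* With a zero denominator the quotient is 0 by convention, which is still at most [l]. *)
move=> l0 a0 k0; have [ak|ak] := eqVneq (a + k) 0.
  by rewrite ak invr0 mulr0 ltW.
have ak0 : 0 < a + k by rewrite lt_neqAle eq_sym ak addr_ge0.
by rewrite ler_pdivrMr// ler_pM2l// lerDl.
Qed.

Lemma ratio_lt (R : realFieldType) (l a k : R) : 0 < l -> 0 <= a -> 0 < k ->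
  l * a / (a + k) < l.
Proof.
move=> l0 a0 k0; have ak0 : 0 < a + k by rewrite ltr_wpDl.
by rewrite ltr_pdivrMr// ltr_pM2l// ltrDl.
Qed.

Theorem proposition3p4 (R : realType) (n : nat) (M : ptopologicalType)
    (A : smooth_atlas R n M) (g : riemannian_metric A)
    (mu : {measure set (borel M) -> \bar R})
    (M_hausdorff : hausdorff_space M)
    (M_compact : compact [set: M])
    (M_connected : connected [set: M])
    (mu_riemannian : is_riemannian_measure g mu)
    (f : M -> R) (f_smooth : smooth A f) (f_pos : forall p, 0 < f p)
    (lambda1 : R) (lambda1_first : is_first_eigenvalue g lambda1) :
  (lambda1_of g mu f <= lambda1%:E)%E /\
  (~ (forall u, laplace_eigenspace g lambda1 u -> L2_orthogonal mu f u) ->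
   (lambda1_of g mu f < lambda1%:E)%E).
Proof.
have [[l0 [u0 u0l u0n]] _] := lambda1_first.
have Cf := smooth_C1M f_smooth.
have vol0 := volume_gt0 M_compact mu_riemannian.
have I2 (u : M -> R) : 0 <= \int[mu]_p (u p ^+ 2).
  by apply: Rintegral_ge0 => p _; exact: sqr_ge0.
split.
  apply: (le_trans (lambda1_of_le_rayleigh M_compact mu_riemannian l0 u0l u0n Cf f_pos)).
  rewrite lee_fin.
  rewrite (rayleigh_subr_cst M_hausdorff M_compact mu_riemannian _ (lt0r_neq0 l0) u0l).
  by apply: ratio_le => //; rewrite mulr_ge0 ?sqr_ge0// ltW.
move=> /existsNP[u] /not_implyP[ul fu].
have Cu : C1M A u by apply: smooth_C1M; case: ul.
(* The zero function is orthogonal to [f], so [u] cannot be zero. *)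
have un : exists p, u p != 0.
  apply/not_existsP => H; apply: fu; rewrite /L2_orthogonal.
  rewrite (_ : (fun p => f p * u p) = cst 0) ?Rintegral_cst ?mul0r//.
  by apply/funext => p; have /negP := H p; rewrite negbK => /eqP ->; rewrite mulr0.
apply: (le_lt_trans (lambda1_of_le_rayleigh M_compact mu_riemannian l0 ul un Cf f_pos)).
rewrite lte_fin (rayleigh_subr_cst M_hausdorff M_compact mu_riemannian _ (lt0r_neq0 l0) ul).
apply: ratio_lt => //; rewrite mulr_gt0// exprn_even_gt0//=.
have fu0 : \int[mu]_p (f p * u p) != 0 by apply/eqP.
(* The numerator of the shift is nonzero by the choice of [u]; a zero denominator would force it to
   be 0. *)
rewrite mulf_neq0// invr_eq0; apply/eqP => If0.
have [C] := Rintegral_mul_le M_compact mu_riemannian Cu Cf f_pos.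
by rewrite If0 mulr0 normr_le0; exact/negP.
Qed.
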